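(* Let $d\ge 1$, $\Omega=[-1/2,1/2]^d$, and let $F:\mathbb{R}^d\to\mathbb{C}$ be measurable and $1$-periodic, with Fourier coefficients $\hat F(k)=\int_\Omega F(x)e^{-2i\pi k\cdot x}dx$ ($k\in\mathbb{Z}^d$), such that $F(x)=\sum_{k\in\mathbb{Z}^d}\hat F(k)e^{2i\pi k\cdot x}$ for almost every $x$ and at $x=0$. Let $X_1,X_2,\dots$ be independent uniformly distributed points in $\Omega$, let $\lambda_1(n),\dots,\lambda_n(n)$ be the eigenvalues of the $n\times n$ matrix $A=(F(X_i-X_j))_{1\le i,j\le n}$, and set $\mu_n=\sum_{i=1}^n\delta_{\lambda_i(n)/n}$ and $\mu=\sum_{k\in\mathbb{Z}^d}\delta_{\hat F(k)}$. Then for all Borel sets $K$ with $\mu(\partial K)=0$ and $0\notin\bar K$, almost surely $$\lim_{n\to\infty}\mu_n(K)=\mu(K).$$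
   Context: $1$-periodic means: if $x,y\in\mathbb{R}^d$ and $x-y\in\mathbb{Z}^d$ then $F(x)=F(y)$. Eigenvalues are counted with multiplicity; $\mu_n$ and $\mu$ are (unnormalized) counting measures on $\mathbb{C}$, $\delta_z$ is the Dirac mass at $z$, and $K$ ranges over Borel subsets of the space containing the eigenvalues ($\mathbb{C}$). $\partial K$ and $\bar K$ denote boundary and closure. *)

(* Defs.v *)
From HB Require Import structures.
From mathcomp Require Import all_boot all_order all_algebra finmap.
From mathcomp Require Import all_classical all_reals all_analysis.
From mathcomp Require Import complex.
From mathcomp.analysis.showcase Require Import summability.

Set Implicit Arguments.
Unset Strict Implicit.
Unset Printing Implicit Defensive.
Import Order.TTheory GRing.Theory Num.Theory.
Import numFieldNormedType.Exports.

Local Open Scope classical_set_scope.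
Local Open Scope ring_scope.
Local Open Scope complex_scope.

(* The library equips every numClosedFieldType with the topology of its norm,
   but that instance is not found for the concrete type R[i]. *)
HB.instance Definition _ (R : realType) :=
  PseudoPointedMetric.copy R[i] R[i]^o.
HB.instance Definition _ (R : realType) := NormedModule.copy R[i] R[i]^o.

Definition borelC (R : realType) := g_sigma_algebraType (@open R[i]).

Section lebesgue_Rd.
Context {R : realType}.

(* R^d is d.-tuple R with the product sigma-algebra of the library. Its
   Lebesgue measure is the d-fold product of lebesgue_measure, carried from
   R * (d.-tuple R) to d.+1.-tuple R one coordinate at a time. *)
Definition tcons d (p : measurableTypeR R * d.-tuple R) : d.+1.-tuple R :=
  [tuple of p.1 :: p.2].

Lemma measurable_tcons d : measurable_fun setT (@tcons d).
Proof.
exact: (@measurable_cons _ _ (measurableTypeR R * d.-tuple R)%type R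
          fst d snd measurable_fst measurable_snd).
Qed.

Definition lebesgue_tcons d
    (mu : {sigma_finite_measure set (d.-tuple R) -> \bar R}) :
    set (d.+1.-tuple R) -> \bar R :=
  pushforward (@lebesgue_measure R \x mu)%E (@tcons d).

Section instances.
Context d (mu : {sigma_finite_measure set (d.-tuple R) -> \bar R}).
Local Notation nu := (lebesgue_tcons mu).

Let mpre A : measurable A -> measurable (@tcons d @^-1` A).
Proof.
by move=> mA; rewrite -[X in measurable X]setTI; exact: measurable_tcons.
Qed.

Let nu0 : nu set0 = 0%E.
Proof. by rewrite /lebesgue_tcons /pushforward preimage_set0 measure0. Qed.

Let nu_ge0 A : (0 <= nu A)%E.
Proof. by rewrite /lebesgue_tcons /pushforward measure_ge0. Qed.

Let nu_sigma_additive : semi_sigma_additive nu.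
Proof.
move=> F mF tF mUF; rewrite /lebesgue_tcons /pushforward preimage_bigcup.
apply: measure_semi_sigma_additive.
- by move=> n; exact: mpre.
- apply/trivIsetP => /= i j _ _ ij; rewrite -preimage_setI.
  by move/trivIsetP : tF => /(_ _ _ _ _ ij) ->//; rewrite preimage_set0.
- by rewrite -preimage_bigcup; exact: mpre.
Qed.

HB.instance Definition _ := isMeasure.Build _ _ _ nu nu0 nu_ge0
  nu_sigma_additive.

Let nu_sigma_finite : sigma_finite setT nu.
Proof.
have /sigma_finiteP[F1 [F1T ndF F1oo]] :=
  sigma_finiteT (@lebesgue_measure R).
have /sigma_finiteP[F2 [F2T ndF2 F2oo]] := sigma_finiteT mu.
pose G n := F1 n `*` F2 n.
have GT : setT = \bigcup_i G i.
  apply/esym; rewrite -subTset => -[x y] _.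
  have [n _ xn] : (\bigcup_i F1 i) x by rewrite -F1T.
  have [k _ yk] : (\bigcup_i F2 i) y by rewrite -F2T.
  exists (maxn n k) => //; split => /=.
    by move: x xn; exact/subsetPset/ndF/leq_maxl.
  by move: y yk; exact/subsetPset/ndF2/leq_maxr.
have Gfin i : measurable (G i) /\ ((@lebesgue_measure R \x mu) (G i) < +oo)%E.
  have [? ?] := F1oo i; have [? ?] := F2oo i.
  split; first exact: measurableX.
  by rewrite product_measure1E// lte_mul_pinfty// ge0_fin_numE.
pose untcons (x : d.+1.-tuple R) : measurableTypeR R * d.-tuple R :=
  (tnth x ord0, [tuple of behead x]).
have tconsK : cancel (@tcons d) untcons.
  by case=> a t; rewrite /untcons tnth0 (_ : [tuple of _] = t)//; exact: val_inj.
have untconsK : cancel untcons (@tcons d).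
  by move=> x; rewrite /tcons/= -tuple_eta.
exists (fun i => untcons @^-1` G i).
  by rewrite -preimage_bigcup -GT preimage_setT.
move=> i; have [mG Goo] := Gfin i; split; last first.
  rewrite /lebesgue_tcons /pushforward -comp_preimage.
  by rewrite (_ : untcons \o _ = id) //; apply/funext => p; exact: tconsK.
rewrite -[X in measurable X]setTI.
have : measurable_fun setT untcons by
  apply/measurable_fun_pair; [exact: measurable_tnth|exact: measurable_behead].
exact.
Qed.

HB.instance Definition _ := Measure_isSigmaFinite.Build _ _ _ nu
  nu_sigma_finite.
End instances.

Fixpoint lebesgue_Rd d : {sigma_finite_measure set (d.-tuple R) -> \bar R} :=
  match d with
  | 0 => @dirac _ (0.-tuple R) [tuple] R
  | d'.+1 => lebesgue_tcons (lebesgue_Rd d')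
  end.

Lemma lebesgue_Rd_box d (A : 'I_d -> set R) :
  (forall i, measurable (A i)) ->
  lebesgue_Rd d [set x | forall i, A i (tnth x i)] =
  (\prod_(i < d) lebesgue_measure (A i))%E.
Proof.
elim: d A => [|d IH] A mA.
  by rewrite big_ord0/= /dirac indicE mem_set// => -[].
rewrite big_ord_recl -IH; last by move=> i; exact: mA.
rewrite /= /lebesgue_tcons /pushforward -product_measure1E; last first.
- rewrite (_ : [set _ | _] =
    \bigcap_(i in [set: 'I_d]) (@tnth d R ^~ i @^-1` A (lift ord0 i))).
    apply: fin_bigcap_measurable => // i _.
    by rewrite -[X in measurable X]setTI; exact: measurable_tnth.
  by apply/seteqP; split=> x /= h i; [move=> _; exact: h|exact: h].
- exact: mA.
congr (_ _); apply/seteqP; split=> -[a t] /= h.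
  split=> [|i]; first by have := h ord0; rewrite tnth0.
  by have := h (lift ord0 i); rewrite tnthS.
case: h => ha ht i; case: (unliftP ord0 i) => [j ->|->].
  by rewrite tnthS; exact: ht.
by rewrite tnth0.
Qed.

End lebesgue_Rd.

Section fourier.
Context {R : realType} {d : nat}.
Implicit Types (x y : d.-tuple R) (k : d.-tuple int) (F : d.-tuple R -> R[i]).

Definition vsub x y : d.-tuple R := [tuple tnth x i - tnth y i | i < d].

Definition vzero : d.-tuple R := [tuple 0 | i < d].

Definition one_periodic F := forall x y,
  (exists k, forall i, tnth (vsub x y) i = (tnth k i)%:~R) -> F x = F y.

Definition Omega : set (d.-tuple R) :=
  [set x | forall i, - 2^-1 <= tnth x i <= 2^-1].

Lemma lebesgue_Omega : lebesgue_Rd d Omega = 1%E.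
Proof.
have -> : Omega = [set x | forall i, `[- 2^-1, 2^-1]%classic (tnth x i)].
  by apply/seteqP; split=> x /= h i; have := h i; rewrite in_itv.
rewrite (@lebesgue_Rd_box R d (fun=> `[- 2^-1, 2^-1]%classic)) => [|_ //].
rewrite big1// => _ _; rewrite lebesgue_measure_itv/= lte_fin.
have h : (- 2^-1 < 2^-1 :> R) by rewrite gtrN// invr_gt0.
by rewrite h opprK -EFinD [in RHS](splitr 1) !mul1r.
Qed.

(* [expi2pi t] is exp(2 i pi t). *)
Definition expi2pi (t : R) : R[i] := cos (2 * pi * t) +i* sin (2 * pi * t).

Definition dot k x : R := \sum_(i < d) (tnth k i)%:~R * tnth x i.

Definition fourier_coef F k : R[i] :=
  let g x := F x * expi2pi (- dot k x) in
  (\int[lebesgue_Rd d]_(x in Omega) complex.Re (g x)) +i*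
  (\int[lebesgue_Rd d]_(x in Omega) complex.Im (g x)).

(* Z^d carries no order, so the series is the limit of its partial sums along
   the finite subsets of Z^d directed by inclusion. *)
Definition fourier_sum_at F x :=
  partial_sum (fun k => fourier_coef F k * expi2pi (dot k x)) @ totally -->
  F x.

Definition fourier_measure F (K : set (borelC R)) : \bar R :=
  (\esum_(k in [set: d.-tuple int]) \d_(fourier_coef F k : borelC R) K)%E.

Definition kernel_matrix F (X : nat -> d.-tuple R) n : 'M[R[i]]_n :=
  \matrix_(i < n, j < n) F (vsub (X i) (X j)).

End fourier.

(* With algebraic multiplicity: the monic polynomial char_poly A is the product
   of the 'X - z%:P for z in this sequence, which has size n. *)
Definition eigenvalues (C : closedFieldType) n (A : 'M[C]_n) : seq C :=
  sval (closed_field_poly_normal (char_poly A)).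

Definition spectral_measure (R : realType) n (A : 'M[R[i]]_n)
    (K : set (borelC R)) : \bar R :=
  (\sum_(z <- eigenvalues A) \d_(z / n%:R : borelC R)%R K)%E.

Definition mutually_independent d d' (T : measurableType d)
    (S : measurableType d') (R : realType) (P : probability T R)
    (X : nat -> T -> S) :=
  forall (J : {fset nat}) (B : nat -> set S),
    (forall j, j \in J -> measurable (B j)) ->
    P (\bigcap_(j in [set` J]) (X j @^-1` B j)) =
    (\prod_(j <- J) P (X j @^-1` B j))%E.

Definition uniform_on (R : realType) d (A : set (d.-tuple R))
    (Q : set (d.-tuple R) -> \bar R) :=
  forall B, measurable B ->
    Q B = (lebesgue_Rd d (B `&` A) / lebesgue_Rd d A)%E.

(* Main.v *)
Require Import Defs.
From mathcomp Require Import all_boot all_order all_algebra finmap.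
From mathcomp Require Import all_classical all_reals all_analysis.
From mathcomp Require Import complex.
From mathcomp Require Import ring lra measurable_realfun.
From mathcomp.analysis.showcase Require Import summability.

(** The proof uses one fact about the coefficients c_k: the series of the
    c_k e_k, with e_k(x) = exp(2 i pi k.x), converges unconditionally to F,
    almost everywhere and at 0.  At 0 every e_k equals 1, and an
    unconditionally convergent series of complex numbers converges absolutely
    ([cvg_small_tail]).

    Let u_k be the vector of the e_k(X_i), i < n.  For i <> j the difference
    X_i - X_j almost surely avoids a given null set ([ae_difference]), so
    almost surely the matrix A is the sum of the c_k u_k (u_k)^t*; on the
    diagonal this is the convergence at 0.  The waves e_k(X_i) are bounded and
    uncorrelated, so a strong law ([strong_law_uncorrelated]) makes the
    vectors u_k asymptotically orthonormal: the inner product of u_k and u_l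
    over n tends to 1 if k = l and to 0 otherwise.  Hence tr ((A / n)^m) tends
    to the sum of the c_k^m for every m > 0 ([moment_cvg_trace]): truncate the
    kernel to finitely many frequencies, where the trace is that of the m-th
    power of a matrix of fixed size, the diagonal of the c_k times a Gram
    matrix tending to the identity.

    It remains to pass from moments to counts.  The matrix A need not
    be normal and its eigenvalues may be complex, so neither the perturbation
    theory of Hermitian matrices nor the density of polynomials in the
    continuous functions is available.  The Schur inequality bounds the sum of
    the |lambda / n|^2 ([sum_norm_eigenvalues]), hence the j-th eigenvalue in
    decreasing order of modulus is O(1 / sqrt j), uniformly in n.  Along an
    ultrafilter all the ranked eigenvalues converge, to limits l_j.  The
    families (l_j) and (c_k) have finitely many members away from 0; a
    polynomial that interpolates there the indicator function of a set, and
    is at most delta |z|^2 near 0 ([indicator_poly]), sees only these members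
    and has almost equal sums over both families, by the convergence of
    moments.  So both families have as many members in any set that stays
    away from 0 ([ultra_count]).  For singletons this says that the nonzero
    limits l_j are coefficients, so they avoid the boundary of K; for K itself
    it then identifies the limit of the counts ([count_cvg]). *)

Set Implicit Arguments.
Unset Strict Implicit.
Unset Printing Implicit Defensive.
Import Order.TTheory GRing.Theory Num.Theory.
Import numFieldNormedType.Exports.
Local Open Scope classical_set_scope.
Local Open Scope ring_scope.

#[local] Existing Instance totally_filter.

(** * Convergence of complex-valued functions *)

(** Continuity of the product, free of any topology, so that it can be
    used for [R[i]] without unfolding the topology of its norm. *)
Lemma near_dist_mul (K : numFieldType) (T : Type) (F : set_system T)
    {FF : Filter F} (f g : T -> K) (l m : K) :
  (forall e, 0 < e -> \forall x \near F, `|l - f x| < e) ->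
  (forall e, 0 < e -> \forall x \near F, `|m - g x| < e) ->
  forall e, 0 < e -> \forall x \near F, `|l * m - f x * g x| < e.
Proof.
by move=> /cvgrPdist_lt fl /cvgrPdist_lt gm; apply/cvgrPdist_lt; exact: cvgM.
Qed.

Section complex_facts.
Context {R : realType}.
Local Notation C := R[i].

Lemma gt0_complexP (e : C) : 0 < e -> exists2 r : R,
    0 < r & e = (real_complex R r).
Proof.
move=> e0; have /complex_realP[r er] : e \is Num.real by rewrite realE ltW.
by exists r => //; move: e0; rewrite er ltcR.
Qed.

Lemma ge0_complexP (e : C) : 0 <= e -> exists2 r : R,
    0 <= r & e = (real_complex R r).
Proof.
move=> e0; have /complex_realP[r er] : e \is Num.real by rewrite realE e0.
by exists r => //; move: e0; rewrite er lecR.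
Qed.

Lemma norm_real_complex (r : R) : `|real_complex R r| = real_complex R `|r|.
Proof. by rewrite normc_def /= expr0n /= addr0 sqrtr_sqr. Qed.

Lemma archi_complex (x : C) : 0 <= x -> exists n : nat, x < n%:R.
Proof.
move=> /ge0_complexP[r r0 ->]; exists (Num.Def.archi_bound r).
have := archi_boundP r0.
by rewrite -ltcR rmorph_nat.
Qed.

Lemma cvg_real_complex (T : Type) (F : set_system T) {FF : Filter F}
    (f : T -> R) (l : R) :
  f @ F --> l -> (fun x => real_complex R (f x)) @ F --> real_complex R l.
Proof.
move=> /cvgrPdist_lt fl; apply/cvgrPdist_lt => _/gt0_complexP[e e0 ->].
apply: filterS (fl e e0) => t; rewrite -rmorphB norm_real_complex.
by rewrite ltcR.
Qed.

Lemma cvgCP (T : Type) (F : set_system T) {FF : Filter F} (f : T -> C) (l : C) :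
  f @ F --> l <-> forall e : C, 0 < e -> \forall x \near F, `|l - f x| < e.
Proof. by split=> [/cvgrPdist_lt|fl]; [exact|apply/cvgrPdist_lt]. Qed.

Lemma cvgMC (T : Type) (F : set_system T) {FF : Filter F} (f g : T -> C)
    (l m : C) :
  f @ F --> l -> g @ F --> m -> (fun x => f x * g x) @ F --> l * m.
Proof.
by move=> /cvgCP fl /cvgCP gm; apply/cvgCP; exact: near_dist_mul.
Qed.

Lemma cvgDC (T : Type) (F : set_system T) {FF : Filter F} (f g : T -> C)
    (l m : C) :
  f @ F --> l -> g @ F --> m -> (fun x => f x + g x) @ F --> l + m.
Proof. exact: (@cvgD C C). Qed.

Lemma cvg_cstC (T : Type) (F : set_system T) {FF : Filter F} (l : C) :
  (fun=> l) @ F --> l.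
Proof. by apply/cvgCP => e e0; apply: nearW => x; rewrite subrr normr0. Qed.

Lemma cvg_ReIm (T : Type) (F : set_system T) {FF : Filter F} (f : T -> C)
    (l : C) :
  (fun x => complex.Re (f x)) @ F --> complex.Re l ->
  (fun x => complex.Im (f x)) @ F --> complex.Im l ->
  f @ F --> l.
Proof.
move=> /cvg_real_complex fr /cvg_real_complex fi.
rewrite [l]complexE.
have -> : f = fun x => (real_complex R (complex.Re (f x)))
   + 'i%C * (real_complex R (complex.Im (f x))).
  by apply/funext => x; exact: complexE.
have ci : (fun=> 'i%C) @ F --> ('i%C : C) by exact: cvg_cstC.
exact: (cvgDC fr (cvgMC ci fi)).
Qed.

Lemma norm_Re (z : C) : `|complex.Re z| <= complex.Re `|z|.
Proof. by rewrite normc_def /= -sqrtr_sqr ler_wsqrtr// lerDl sqr_ge0. Qed.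

Lemma norm_Im (z : C) : `|complex.Im z| <= complex.Re `|z|.
Proof. by rewrite normc_def /= -sqrtr_sqr ler_wsqrtr// lerDr sqr_ge0. Qed.

Lemma ultra_fmap (S T : Type) (U : set_system S) (f : S -> T) :
  UltraFilter U -> UltraFilter (f @ U).
Proof.
move=> UU; split=> [|G GF sG]; first exact: fmap_proper_filter.
rewrite predeqE => A; split=> [GA|]; last exact: sG.
have [//|nA] := in_ultra_setVsetC (f @^-1` A) UU.
have /(filterI GA) : G (~` A) by exact: sG.
by rewrite setICr => /filter_ex [].
Qed.

Lemma ultra_cvgR (S : Type) (U : set_system S) (f : S -> R) (M : R) :
  UltraFilter U -> (forall n, `|f n| <= M) -> exists l : R, f @ U --> l.
Proof.
move=> UU fM.
have := @segment_compact R (- M) M; rewrite compact_ultra =>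
  /(_ (f @ U) (ultra_fmap _ UU)).
case.
  by apply: nearW => n /=; rewrite in_itv /= -ler_norml.
by move=> l [_ fl]; exists l.
Qed.

(** Bounded sequences converge along an ultrafilter: this replaces the
    extraction of subsequences, simultaneously for countably many sequences. *)
Lemma ultra_cvgC (S : Type) (U : set_system S) (f : S -> C) (M : C) :
  UltraFilter U -> (forall n, `|f n| <= M) -> exists l : C, f @ U --> l.
Proof.
move=> UU fM.
have [r fr] : exists r : R, (fun x => complex.Re (f x)) @ U --> r.
  apply: (@ultra_cvgR _ _ _ (complex.Re M)) => // n;
    apply: (le_trans (norm_Re _)).
  by have := fM n; rewrite lecE => /andP[].
have [i fi] : exists r : R, (fun x => complex.Im (f x)) @ U --> r.
  apply: (@ultra_cvgR _ _ _ (complex.Re M)) => // n;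
    apply: (le_trans (norm_Im _)).
  by have := fM n; rewrite lecE => /andP[].
by exists (r +i* i)%C; apply: cvg_ReIm.
Qed.

End complex_facts.

(** * Unconditionally convergent families *)

Section unconditional.
Context {R : realType} {I : choiceType}.
Local Notation C := R[i].

Lemma partial_sumE (V : zmodType) (c : I -> V) (S : {fset I}) :
  partial_sum c S = \sum_(k <- S) c k.
Proof. exact: (esym (big_seq_fsetE +%R S predT c)). Qed.

Lemma sum_fsetU (V : zmodType) (c : I -> V) (A B : {fset I}) :
  [disjoint A & B]%fset ->
  \sum_(k <- (A `|` B)%fset) c k = \sum_(k <- A) c k + \sum_(k <- B) c k.
Proof.
move=> /fdisjointP dAB; rewrite (big_fsetID _ (mem A)) /=.
congr (_ + _); congr (\sum_(k <- enum_fset _) c k).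
  by apply/fsetP => x; rewrite !inE andb_orl andbb; case: (x \in A);
    rewrite ?andbF.
apply/fsetP => x; rewrite !inE; have [/dAB/negbTE->//|//] := boolP (x \in A).
by rewrite andbT.
Qed.

(** Absolute summability, stated without naming the sum. *)
Definition small_tail (c : I -> C) := forall e : C, 0 < e ->
  exists S0 : {fset I}, forall T : {fset I}, [disjoint S0 & T]%fset ->
    \sum_(k <- T) `|c k| <= e.

(** The terms of each sign are a subfamily, so their sum is controlled. *)
Lemma real_abs_tail (T : {fset I}) (g : I -> R) (e : R) :
  (forall T' : {fset I}, (T' `<=` T)%fset -> `|\sum_(k <- T') g k| <= e) ->
  \sum_(k <- T) `|g k| <= e + e.
Proof.
move=> He.
have fE (p : pred I) : \sum_(k <- T | p k) g k =
  \sum_(k <- [fset k in T | p k]%fset) g k.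
  rewrite [RHS]big_fset /= ; apply: congr_big => //.
rewrite (bigID (fun k => 0 <= g k)) /=; apply: lerD.
  rewrite (eq_bigr g) => [|k]; last exact: ger0_norm.
  by rewrite fE (le_trans (ler_norm _))// He//; apply: fset_sub.
rewrite (eq_bigr (fun k => - g k)) => [|k]; last first.
  by rewrite -ltNge => /ltW/ler0_norm.
rewrite sumrN fE (le_trans (ler_norm _))// normrN He//; apply: fset_sub.
Qed.

(** Two partial sums that contain a large finite set are close, so every
    finite sum off that set is small; the real and the imaginary parts then
    have small absolute sums by [real_abs_tail]. *)
Lemma cvg_small_tail (c : I -> C) (l : C) :
  partial_sum c @ totally --> l -> small_tail c.
Proof.
move=> /cvgrPdist_lt cl _/gt0_complexP[e e0 ->].
have e8 : 0 < e / 8 by rewrite divr_gt0.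
have /= := cl (real_complex R (e/8)); rewrite ltcR => /(_ e8) [S0 _ HS0].
exists S0 => T dT.
have HT (T' : {fset I}) : (T' `<=` T)%fset ->
    `|\sum_(k <- T') c k| <= real_complex R (e/4).
  move=> T'T; have dT' : [disjoint S0 & T']%fset by exact: fdisjointWr dT.
  have -> : \sum_(k <- T') c k = (l - partial_sum c S0) -
    (l - partial_sum c (S0 `|` T')%fset).
    by rewrite !partial_sumE sum_fsetU//; ring.
  apply: le_trans (ler_normB _ _) _.
  have -> : e / 4 = e / 8 + e / 8 by field.
  rewrite rmorphD; apply: lerD; apply/ltW/HS0 => /=; first exact: fsubset_refl.
  exact: fsubsetUl.
have Hre (g : C -> R) : {morph g : x y / x + y} -> g 0 = 0 ->
  (forall z, `|g z| <= complex.Re `|z|) ->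
    \sum_(k <- T) `|g (c k)| <= e/2.
  move=> gD g0 gn; have -> : e/2 = e/4 + e/4 by field.
  apply: real_abs_tail => T' T'T.
  rewrite -(big_morph g gD g0) (le_trans (gn _))//.
  by have := HT T' T'T; rewrite lecE => /andP[].
apply: (@le_trans _ _ (\sum_(k <- T) real_complex R
  (`|complex.Re (c k)| + `|complex.Im (c k)|))).
  apply: ler_sum => k _; rewrite [X in `|X| <= _]complexE
    (le_trans (ler_normD _ _))//.
  by rewrite normrM !norm_real_complex normc_def /= expr0n expr1n add0r sqrtr1
    mul1r rmorphD.
rewrite -rmorph_sum lecR big_split /= [leRHS]splitr; apply: lerD; apply: Hre.
- by move=> [a b] [a' b'].
- by [].
- exact: norm_Re.
- by move=> [a b] [a' b'].
- by [].
- exact: norm_Im.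
Qed.

End unconditional.

(** * Polynomials that approximate indicator functions *)

Section indicator.
Context {R : realType}.
Local Notation C := R[i].

Lemma exp2_archi (x : C) : 0 <= x -> exists m : nat, x <= 2 ^+ m.
Proof.
move=> /archi_complex[n xn]; exists n; apply: (le_trans (ltW xn)).
by rewrite -natrX ler_nat ltnW// ltn_expl.
Qed.

(** Take the sum of the 'X^m / a ^+ m times the Lagrange polynomial of a,
    over the nodes a that satisfy P.  As |a| is at least rho, the factor
    (z / a) ^+ m is at most 2 ^- m for |z| <= rho / 2, while the Lagrange
    polynomials do not depend on m and are bounded on that disk.  The factor
    'X^2 is set apart since only moments of order at least 2 are dominated. *)
Lemma indicator_poly (B : seq C) (P : pred C) (rho delta : C) :
  0 < rho -> 0 < delta -> (forall z, P z -> rho <= `|z|) ->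
  exists h : {poly C},
    (forall b, b \in B -> ('X^2 * h).[b] = (P b)%:R) /\
    (forall z, `|z| <= rho / 2 -> `|h.[z]| <= delta).
Proof.
move=> rho0 delta0 Prho.
pose q a := \prod_(b <- undup B | b != a) ((a - b)^-1 *: ('X - b%:P)).
pose Dq a := poly_disk_bound (q a) (rho / 2).
pose D := \sum_(a <- undup B | P a) rho ^- 2 * sval (Dq a).
have D_ge0 a : 0 <= sval (Dq a).
  apply: le_trans (svalP (Dq a) 0 _); first exact: normr_ge0.
  by rewrite normr0 divr_ge0 ?ltW.
have [m Hm] : exists m : nat, D / delta <= 2 ^+ m.
  apply: exp2_archi; rewrite divr_ge0 ?(ltW delta0)// sumr_ge0// => a _.
  by rewrite mulr_ge0// invr_ge0 exprn_ge0 ?ltW.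
exists (\sum_(a <- undup B | P a) (a ^- 2 *: ((a^-1 *: 'X) ^+ m * q a))); split.
  move=> b bB; rewrite hornerM hornerXn horner_sum.
  have P0 a : P a -> a != 0.
    by move=> /Prho; apply: contraTneq => ->; rewrite normr0 lt_geF.
  have qab a : a \in B -> (q a).[b] = (b == a)%:R.
    move=> aB; rewrite /q horner_prod; have [->|ba] := eqVneq b a.
      rewrite big1// => c ca; rewrite !hornerE /= mulVf// subr_eq0 eq_sym//.
    rewrite big_mkcond (bigD1_seq b) ?mem_undup ?undup_uniq//= ba.
    by rewrite !hornerE /= subrr mulr0 mul0r.
  have [Pb|nPb] := boolP (P b); last first.
    rewrite [X in _ * X](_ : _ = 0) ?mulr0// big_seq_cond.
    apply: big1 => a /andP[]; rewrite mem_undup => aB Pa.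
    rewrite !hornerE /= qab//; have [ba|] := eqVneq b a;
      last by rewrite mulr0n !mulr0.
    by rewrite ba Pa in nPb.
  rewrite big_mkcond (bigD1_seq b) ?undup_uniq ?mem_undup//= Pb.
  rewrite [X in _ * (_ + X)](_ : _ = 0) ?addr0; last first.
    rewrite big_seq_cond; apply: big1 => a /andP[].
    rewrite mem_undup => aB ab; case: ifP => // Pa; rewrite !hornerE /= qab//.
    by rewrite eq_sym (negbTE ab) mulr0n !mulr0.
  by rewrite !hornerE /= qab// eqxx mulr1 mulVf ?P0// expr1n mulr1 divff//
    expf_neq0// P0.
move=> z zrho; rewrite horner_sum (le_trans (ler_norm_sum _ _ _))//.
apply: (@le_trans _ _ (\sum_(a <- undup B | P a)
  (2 ^- m * (rho ^- 2 * sval (Dq a))))).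
  apply: ler_sum => a Pa; rewrite !hornerE /= [_ ^- 2 * _]mulrC !normrM.
  have a0 : 0 < `|a| by apply: lt_le_trans (Prho _ Pa).
  rewrite normrX normrM !normfV normrX -!mulrA.
  apply: ler_pM.
  - by rewrite exprn_ge0 ?mulr_ge0 ?invr_ge0.
  - by rewrite mulr_ge0 ?invr_ge0 ?exprn_ge0.
  - rewrite -exprVn; apply: lerXn2r; rewrite ?nnegrE ?mulr_ge0//.
    rewrite mulrC ler_pdivrMr// (le_trans zrho)// mulrC ler_pM2l ?invr_gt0//.
    exact: Prho.
  - apply: ler_pM => //; last exact: (svalP (Dq a)).
    rewrite lef_pV2 ?posrE ?exprn_gt0//; apply: lerXn2r; last exact: Prho.
      by rewrite nnegrE ltW.
    by rewrite nnegrE ltW.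
rewrite -mulr_sumr -/D mulrC ler_pdivrMr ?exprn_gt0// mulrC.
by rewrite -ler_pdivrMr.
Qed.

End indicator.

(** * Counting points from their moments *)

Lemma cvg_hornerC (R : realType) (T : Type) (F : set_system T) {FF : Filter F}
    (f : T -> R[i]) (l : R[i]) (p : {poly R[i]}) :
  f @ F --> l -> (fun x => p.[f x]) @ F --> p.[l].
Proof.
move=> fl; elim/poly_ind: p => [|p a IH].
  rewrite horner0; under eq_fun do rewrite horner0.
  exact: cvg_cstC.
rewrite hornerMXaddC; under eq_fun do rewrite hornerMXaddC.
have ca : (fun=> a) @ F --> (a : R[i]) by exact: cvg_cstC.
exact: (cvgDC (cvgMC IH fl) ca).
Qed.

Lemma cvg_sumC (R : realType) (T : Type) (F : set_system T) {FF : Filter F}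
    (J : Type) (s : seq J) (f : J -> T -> R[i]) (l : J -> R[i]) :
  (forall j, f j @ F --> l j) ->
  (fun x => \sum_(j <- s) f j x) @ F --> \sum_(j <- s) l j.
Proof.
move=> fl; elim: s => [|j s IH].
  rewrite big_nil; under eq_fun do rewrite big_nil.
  exact: cvg_cstC.
rewrite big_cons; under eq_fun do rewrite big_cons.
exact: (cvgDC (fl j) IH).
Qed.

Lemma sum_nth_widen (A : Type) (V : nmodType) (x0 : A) (s : seq A) (f : A -> V)
    N :
  f x0 = 0 -> (size s <= N)%N ->
  \sum_(z <- s) f z = \sum_(0 <= j < N) f (nth x0 s j).
Proof.
move=> f0 sN; rewrite (big_nth x0) (@big_cat_nat _ _ _ (size s) 0 N)//=.
rewrite [X in _ + X]big_nat_cond [X in _ + X]big1 ?addr0// =>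
  j /andP[/andP[sj _] _].
by rewrite nth_default.
Qed.

Section counting.
Context {R : realType} {I : choiceType}.
Local Notation C := R[i].
Variables (L : nat -> seq C) (c : I -> C) (M : C).

(** Agreement, in the limit, of the sums of f over the points L n and over
    the family c.  The sum over c is not named: it enters only through its
    finite partial sums. *)
Definition moment_cvg (f : C -> C) := forall e : C, 0 < e ->
  \forall S \near totally, \forall n \near \oo,
    `|\sum_(z <- L n) f z - \sum_(k <- (S : {fset I})) f (c k)| < e.

Lemma moment_cvgD f g : moment_cvg f -> moment_cvg g ->
  moment_cvg (fun z => f z + g z).
Proof.
move=> fc gc e e0; have e20 : 0 < e / 2 by rewrite divr_gt0.
apply: filterS2 (fc _ e20) (gc _ e20) => S; apply: filterS2 => n fn gn.
rewrite !big_split /= opprD addrACA (le_lt_trans (ler_normD _ _))//.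
by rewrite [ltRHS]splitr ltrD.
Qed.

Lemma moment_cvgZ a f : moment_cvg f -> moment_cvg (fun z => a * f z).
Proof.
move=> fc e e0; have a1 : 0 < `|a| + 1 by rewrite ltr_wpDl.
have ea0 : 0 < e / (`|a| + 1) by rewrite divr_gt0.
apply: filterS (fc _ ea0) => S; apply: filterS => n fn.
rewrite -!mulr_sumr -mulrBr normrM.
apply: (@le_lt_trans _ _ ((`|a| + 1) * `|\sum_(z <- L n) f z - \sum_(k <- S) f
  (c k)|)).
  by rewrite ler_wpM2r// lerDl.
by rewrite mulrC -ltr_pdivlMr.
Qed.

Hypothesis LM : forall n, \sum_(z <- L n) `|z| ^+ 2 <= M.
Hypothesis cM : forall S : {fset I}, \sum_(k <- S) `|c k| ^+ 2 <= M.
Hypothesis c_tail : small_tail c.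
Hypothesis moments : forall m, (2 <= m)%N -> moment_cvg (fun z => z ^+ m).

Lemma moment_cvg_poly (h : {poly C}) :
  moment_cvg (fun z => ('X^2 * h).[z]).
Proof.
suff H m : (2 <= m)%N -> moment_cvg (fun z => ('X^m * h).[z]) by exact: H.
elim/poly_ind: h m => [|h a IH] m m2.
  have -> : (fun z => ('X^m * (0 : {poly C})).[z]) = (fun z => 0 * z ^+ 2).
    by apply/funext => z; rewrite mulr0 horner0 mul0r.
  by apply: moment_cvgZ; exact: moments.
have -> : (fun z => ('X^m * (h * 'X + a%:P)).[z]) =
    (fun z => ('X^(m.+1) * h).[z] + a * z ^+ m).
  apply/funext => z; rewrite !(hornerM, hornerD, hornerX, hornerC,
    hornerXn) exprS.
  by ring.
apply: moment_cvgD; first by apply: IH; rewrite ltnW.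
by apply: moment_cvgZ; exact: moments.
Qed.

Let M_ge0 : 0 <= M.
Proof. by have := cM fset0; rewrite big_seq_fset0. Qed.

Let norm_geq : rel C := fun x y => `|y| <= `|x|.

(** The default value 0 pads the list, so that every rank is defined for
    every n. *)
Definition ranked (n j : nat) : C := nth 0 (sort norm_geq (L n)) j.

Lemma sum_ranked (V : nmodType) (f : C -> V) n J : f 0 = 0 ->
  \sum_(z <- L n) f z = \sum_(0 <= j < J) f (ranked n j) +
    \sum_(J <= j < maxn J (size (L n))) f (ranked n j).
Proof.
move=> f0.
rewrite -big_cat_nat ?leq_maxl//= -sum_nth_widen//; last first.
  by rewrite size_sort leq_maxr.
by apply: perm_big; rewrite perm_sym perm_sort.
Qed.

(** The first j.+1 ranked points all have at least the modulus of the
    last one. *)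
Lemma ranked_bound n j : j.+1%:R * `|ranked n j| ^+ 2 <= M.
Proof.
have [js|js] := leqP (size (L n)) j.
  by rewrite /ranked nth_default ?size_sort// normr0 expr0n mulr0.
have tot : total norm_geq by move=> x y; rewrite /norm_geq real_leVge.
apply: le_trans (LM n).
rewrite (@sum_ranked C (fun z => `|z| ^+ 2) n j.+1) ?normr0 ?expr0n//.
apply: ler_wpDr; first by apply: sumr_ge0 => i _; exact: exprn_ge0.
rewrite -[X in X%:R]card_ord -sum1_card natr_sum mulr_suml.
rewrite big_mkord; apply: ler_sum => i _; rewrite mul1r.
apply: lerXn2r; rewrite ?nnegrE//.
have := @sorted_leq_nth _ norm_geq _ _ 0 _ (sort_sorted tot (L n)) i j.
apply; rewrite ?inE ?size_sort//.
- by move=> x y z xy yz; exact: le_trans yz xy.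
- by move=> x; exact: lexx.
- exact: leq_trans (ltn_ord i) js.
- by rewrite -ltnS; exact: ltn_ord.
Qed.

Section ultra.
Context (U : set_system nat) (UU : UltraFilter U) (ooU : \oo `<=` U).
Variables (l : nat -> C) (rho : C) (J : nat) (S0 : {fset I}).
Hypothesis el : forall j, ranked ^~ j @ U --> l j.
Hypothesis rho0 : 0 < rho.
Hypothesis HJ : forall n j, (J <= j)%N -> `|ranked n j| <= rho / 2.
Hypothesis HS0 : forall k, k \notin S0 -> `|c k| <= rho / 2.

(** Sum the polynomial of [indicator_poly] over L n and over c.  Its
    values at the limits l j and at the c k of index in S0 count those that
    satisfy P, and the remaining points contribute at most delta * M.  The two
    integers then differ by less than 1. *)
Lemma ultra_count (P : pred C) : (forall z, P z -> rho <= `|z|) ->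
  (\sum_(0 <= j < J) P (l j) = \sum_(k <- S0) P (c k))%N.
Proof.
move=> Prho.
have q0 : 0 < 4^-1 :> C by rewrite invr_gt0.
have M1 : 0 < M + 1 by rewrite ltr_wpDl.
(* Four errors have to add up to less than 1. *)
pose delta := 4^-1 / (M + 1).
have delta0 : 0 < delta by rewrite divr_gt0.
have deltaM : delta * M <= 4^-1.
  by rewrite /delta mulrAC ler_pdivrMr// ler_wpM2l ?lerDl// ltW.
have [h [hB hsmall]] := indicator_poly
  (map l (index_iota 0 J) ++ map c S0) rho0 delta0 Prho.
pose g z := ('X^2 * h).[z].
have gsmall z : `|z| <= rho / 2 -> `|g z| <= delta * `|z| ^+ 2.
  move=> /hsmall hz; rewrite /g hornerM hornerXn normrM normrX mulrC.
  by rewrite ler_wpM2r// exprn_ge0.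
have [A _ HA] := moment_cvg_poly h q0.
have /HA/ooU H1 : (A `<=` A `|` S0)%fset by exact: fsubsetUl.
have /cvgCP/(_ _ q0) H2 : (fun n => \sum_(0 <= j < J) g (ranked n j)) @ U -->
    \sum_(0 <= j < J) g (l j).
  by apply: cvg_sumC => j; exact: cvg_hornerC.
have [n [/= {}H1 {}H2]] := filter_ex (filterI H1 H2).
have g0 : g 0 = 0 by rewrite /g !hornerE /= expr0n /= mul0r.
have EN := sum_ranked n J g0; set N := maxn J _ in EN.
have N1 : \sum_(0 <= j < J) g (l j) = (\sum_(0 <= j < J) P (l j))%N%:R.
  rewrite natr_sum; apply: eq_big_nat => j jJ; apply: hB.
  by rewrite mem_cat map_f// mem_index_iota.
have N2 : \sum_(k <- S0) g (c k) = (\sum_(k <- S0) P (c k))%N%:R.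
  rewrite natr_sum; apply: eq_big_seq => k kS0; apply: hB.
  by rewrite mem_cat map_f ?orbT.
have SE : \sum_(k <- (A `|` S0)%fset) g (c k) =
   \sum_(k <- S0) g (c k) + \sum_(k <- (A `\` S0)%fset) g (c k).
  rewrite -sum_fsetU; last by apply/fdisjointP => k; rewrite !inE => ->.
  by congr (\sum_(k <- enum_fset _) _); apply/fsetP => k; rewrite !inE;
    case: (k \in S0); rewrite ?orbT ?orbF.
apply/eqP; rewrite -(eqr_nat C) -subr_eq0 -normr_eq0.
have : `|(\sum_(0 <= j < J) P (l j))%N%:R - (\sum_(k <- S0) P (c k))%N%:R| < 1
  :> C.
  rewrite -N1 -N2.
  have -> : \sum_(0 <= j < J) g (l j) - \sum_(k <- S0) g (c k) =
    (\sum_(0 <= j < J) g (l j) - \sum_(0 <= j < J) g (ranked n j))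
    + (\sum_(z <- L n) g z - \sum_(k <- (A `|` S0)%fset) g (c k))
    + (\sum_(k <- (A `\` S0)%fset) g (c k) - \sum_(J <= j < N) g (ranked n j)).
    by rewrite EN SE; ring.
  have -> : 1 = 4^-1 + 4^-1 + (4^-1 + 4^-1) :> C by field.
  apply: (le_lt_trans (ler_normD _ _)); apply: ltr_leD.
    by apply: (le_lt_trans (ler_normD _ _)); apply: ltrD.
  apply: (le_trans (ler_normB _ _)); apply: lerD.
    apply: (le_trans (ler_norm_sum _ _ _)); apply: le_trans deltaM.
    apply: (@le_trans _ _ (\sum_(k <- (A `\` S0)%fset) delta * `|c k| ^+ 2)).
      rewrite !big_seq; apply: ler_sum => k; rewrite !inE => /andP[kS0 _].
      by apply: gsmall; exact: HS0.
    by rewrite -mulr_sumr ler_wpM2l// ltW.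
  apply: (le_trans (ler_norm_sum _ _ _)); apply: le_trans deltaM.
  apply: (@le_trans _ _ (delta * \sum_(J <= j < N) `|ranked n j| ^+ 2)).
    rewrite mulr_sumr !big_nat; apply: ler_sum => j /andP[jJ _].
    by apply: gsmall; exact: HJ.
  rewrite ler_wpM2l ?(ltW delta0)//; apply: le_trans (LM n).
  rewrite (@sum_ranked C (fun z => `|z| ^+ 2) n J) ?normr0 ?expr0n// -/N.
  by rewrite ler_wpDl// sumr_ge0// => j _; exact: exprn_ge0.
set a := (X in X%:R - _); set b := (X in _ - X%:R).
have [ba|ab] := leqP b a.
  rewrite -natrB// normr_nat -[1]/(1%:R) ltr_nat ltnS leqn0 => /eqP ->.
  by [].
rewrite distrC -natrB ?(ltnW ab)// normr_nat -[1]/(1%:R) ltr_nat ltnS leqn0 =>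
  /eqP ->.
by [].
Qed.

End ultra.

(** If the counts differed from the expected value infinitely often, an
    ultrafilter would contain the set of these n.  Along it the j-th ranked
    points converge, and a limit of modulus at least rho is a member of c, by
    [ultra_count] for singletons, hence not on the boundary of K.  So the
    points eventually lie in K exactly when their limits do, and
    [ultra_count] for K gives the expected count. *)
Lemma count_cvg (K : set C) (rho : C) : 0 < rho ->
    (forall z, K z -> rho <= `|z|) ->
  (forall k, ~ (closure K `\` interior K) (c k)) ->
  exists S0 : {fset I}, (forall k, K (c k) -> k \in S0) /\
    \forall n \near \oo,
      (\sum_(z <- L n) `[< K z >] = \sum_(k <- S0) `[< K (c k) >])%N.
Proof.
move=> rho0 Krho dK; have rho20 : 0 < rho / 2 by rewrite divr_gt0.
have [S0 HS0] := c_tail rho20.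
have {}HS0 k : k \notin S0 -> `|c k| <= rho / 2.
  move=> kS0; have := HS0 [fset k]%fset; rewrite big_seq_fset1; apply.
  by rewrite fdisjointX1.
have rho_half : rho / 2 < rho by rewrite ltr_pdivrMr// ltr_pMr// ltr1n.
have Krho2 z : K z -> ~ `|z| <= rho / 2.
  move=> /Krho h /(le_trans h); rewrite lt_geF//.
exists S0; split=> [k Kk|].
  by apply: contrapT => /negP /HS0; exact: Krho2.
have [J HJ] : exists J : nat, M / (rho / 2) ^+ 2 < J%:R.
  by apply: archi_complex; rewrite divr_ge0// exprn_ge0// ltW.
have {}HJ n j : (J <= j)%N -> `|ranked n j| <= rho / 2.
  move=> jJ; have [//|lt_ev] :=
    real_leP (normr_real (ranked n j)) (gtr0_real rho20).
  have := ranked_bound n j; rewrite lt_geF//.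
  move: HJ; rewrite ltr_pdivrMr ?exprn_gt0// => /lt_le_trans; apply.
  apply: ler_pM => //.
  - by rewrite exprn_ge0// ltW.
  - by rewrite ler_nat ltnW.
  - by apply: lerXn2r; rewrite ?nnegrE// ltW.
set N := (\sum_(k <- S0) _)%N.
pose E := [set n | (\sum_(z <- L n) `[< K z >])%N = N].
apply: contrapT => nE.
have GP : ProperFilter (within (~` E) \oo).
  split; last exact: within_filter.
  rewrite /within /= => h; apply: nE; apply: filterS h => n /= h.
  exact: contrapT.
(* U refines the filter of the n at which the count is wrong. *)
have [U [UU GU]] := ultraFilterLemma GP.
have ooU : \oo `<=` U by move=> A oA; apply: GU; apply: filterS oA => n An _.
have UnE : U (~` E) by apply: GU; rewrite /within/=; apply: nearW.
have {GU GP nE}el j : exists l : C, ranked ^~ j @ U --> l.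
  apply: (@ultra_cvgC _ _ _ _ (M + 1)) => // n.
  have [e1|e1] := real_leP (normr_real (ranked n j)) (@real1 C).
    by rewrite (le_trans e1)// lerDr.
  rewrite ler_wpDr// (le_trans _ (ranked_bound n j))//.
  apply: (@le_trans _ _ (1 * `|ranked n j| ^+ 2)).
    by rewrite mul1r expr2 ler_peMl// ltW.
  by apply: ler_wpM2r; rewrite ?exprn_ge0// ler1n.
have {el}[l el] := choice el.
have cnt := ultra_count UU ooU el rho0 HJ HS0.
have lK j : (j < J)%N -> U [set n | K (ranked n j) <-> K (l j)].
  move=> jJ; have [lrho|lrho] := real_ltP (normr_real (l j)) (gtr0_real rho0).
    have /cvgCP/(_ (rho - `|l j|)) := el j; rewrite subr_gt0 => /(_ lrho).
    apply: filterS => n; rewrite ltrBrDl => h; split => /Krho.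
      rewrite lt_geF//; apply: le_lt_trans h.
      by rewrite -{1}(subKr (l j) (ranked n j)) (le_trans (ler_normB _ _)).
    by rewrite lt_geF.
  have [k lck] : exists k, l j = c k.
    apply: contrapT => nk.
    have Plj z : pred1 (l j) z -> rho <= `|z| by move=> /eqP ->.
    have := cnt (pred1 (l j)) Plj.
    rewrite big_mkord (bigD1 (Ordinal jJ))//= eqxx.
    rewrite [RHS]big1 => [//|k _].
    by apply/eqP; rewrite eqb0; apply/eqP => ck; apply: nk; exists k.
  have [Kl|nKl] := pselect (interior K (l j)).
    have Kn : U [set n | K (ranked n j)] by exact: el.
    by apply: filterS Kn => n Kn; split => // _; exact: interior_subset Kl.
  have ncl : (~` closure K) (l j).
    by move=> cl; apply: (dK k); rewrite -lck.
  have ncK : nbhs (l j) (~` closure K).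
    by apply: open_nbhs_nbhs; split=> //; apply: closed_openC;
      exact: closed_closure.
  have Kn : U [set n | ~ closure K (ranked n j)] by exact: el ncK.
  apply: filterS Kn => n Kn; split=> Hk; exfalso.
    by apply: Kn; exact: (@subset_closure C K _ Hk).
  by apply: ncl; exact: (@subset_closure C K _ Hk).
have {}lK : U [set n | forall j, (j < J)%N -> K (ranked n j) <-> K (l j)].
  have UF := @filter_forall _ 'I_J (fun j =>
    [set n | K (ranked n j) <-> K (l j)]) U _
    (fun j => lK j (ltn_ord j)).
  have FU : Filter U by exact: (@filter_filter _ _ (@ultra_proper _ _ UU)).
  apply: filterS (UF FU) => n h j jJ; exact: (h (Ordinal jJ)).
have [n [nE /= nlK]] := filter_ex (filterI UnE lK).
apply: nE; rewrite /E/= /N -(cnt (fun z => `[< K z >])); last first.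
  by move=> z /asboolP /Krho.
have K0 : `[< K 0 >] = false.
  by apply/asboolP => /Krho; rewrite normr0 lt_geF.
have f0 : (`[< K 0 >] : nat) = 0 by rewrite K0.
have -> := @sum_ranked nat (fun z => `[< K z >] : nat) n J f0.
rewrite [X in (_ + X)%R](_ : _ = 0) ?addr0.
  apply: eq_big_nat => j /andP[_ jJ]; congr nat_of_bool.
  by apply/asboolP/asboolP => /nlK; exact.
rewrite big_nat; apply: big1 => j /andP[jJ _].
by case: asboolP => // /Krho2; have := HJ n j jJ.
Qed.

End counting.

(** * Eigenvalues, traces of powers and the Schur inequality *)

Section eigenvalues_facts.
Local Open Scope sesquilinear_scope.
Context {C : numClosedFieldType}.

Lemma mulmx_trig n (A B : 'M[C]_n) : is_trig_mx A -> is_trig_mx B ->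
  is_trig_mx (A *m B) /\ forall i, (A *m B) i i = A i i * B i i.
Proof.
move=> /is_trig_mxP tA /is_trig_mxP tB; split.
  apply/is_trig_mxP => i j ij; rewrite mxE big1// => k _.
  have [ik|ki] := ltnP i k; first by rewrite tA// mul0r.
  by rewrite tB ?mulr0// (leq_ltn_trans ki).
move=> i; rewrite mxE (bigD1 i)//= big1 ?addr0// => k ki.
have [ik|ik|/val_inj ik] := ltngtP i k.
- by rewrite tA// mul0r.
- by rewrite tB// mulr0.
- by rewrite ik eqxx in ki.
Qed.

Lemma exp_trig n (A : 'M[C]_n) m : is_trig_mx A ->
  is_trig_mx (A ^+ m) /\ forall i, (A ^+ m) i i = A i i ^+ m.
Proof.
move=> tA; elim: m => [|m [IH1 IH2]].
  by split=> [|i]; [exact: scalar_mx_is_trig|rewrite mxE eqxx].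
rewrite exprS; have [t1 t2] := mulmx_trig tA IH1; split=> // i.
by rewrite t2 IH2 exprS.
Qed.

(** Unitary triangularization, extended to matrices of size 0. *)
Lemma schur_form n (A : 'M[C]_n) : exists P T : 'M[C]_n,
  [/\ P *m P ^t* = 1%:M, is_trig_mx T & A = P ^t* *m T *m P].
Proof.
case: n A => [|n] A.
  exists 1%:M, 0; split; first by apply/matrixP => -[].
    exact: mx0_is_trig.
  by apply/matrixP => -[].
have [P Pu tP] := Schur A (ltn0Sn n); exists P, (conjmx P A).
have PP : P *m P ^t* = 1%:M by apply/eqP; move: Pu; rewrite qualifE.
split=> //; rewrite conjymx// !mulmxA.
by rewrite -(invmx_unitary Pu) mulVmx ?unitarymx_unit// mul1mx mulmxKV
  ?unitarymx_unit.
Qed.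

Lemma char_poly_unitary_conj n (P T : 'M[C]_n) : P *m P ^t* = 1%:M ->
  char_poly (P ^t* *m T *m P) = char_poly T.
Proof.
move=> PP; have PP' : P ^t* *m P = 1%:M by exact: mulmx1C.
rewrite /char_poly.
have -> : char_poly_mx (P ^t* *m T *m P) =
    map_mx polyC (P ^t*) *m char_poly_mx T *m map_mx polyC P.
  rewrite /char_poly_mx mulmxBr mulmxBl; congr (_ - _).
    by rewrite scalar_mxC -mulmxA -map_mxM PP' map_scalar_mx mulmx1.
  by rewrite !map_mxM.
rewrite !det_mulmx mulrAC -det_mulmx -map_mxM PP' map_scalar_mx det1 mul1r.
by [].
Qed.

Lemma eigenvalues_trig n (P T : 'M[C]_n) : P *m P ^t* = 1%:M -> is_trig_mx T ->
  perm_eq (eigenvalues (P ^t* *m T *m P)) [seq T i i | i <- index_enum 'I_n].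
Proof.
move=> PP tT; apply/prod_XsubC_eq; rewrite /eigenvalues.
case: closed_field_poly_normal => r /= rE.
rewrite big_map -char_poly_trig// -(char_poly_unitary_conj T PP) [RHS]rE.
by rewrite (monicP (char_poly_monic _)) scale1r.
Qed.

Lemma expmx_unitary_conj n (P T : 'M[C]_n) m : P *m P ^t* = 1%:M ->
  (P ^t* *m T *m P) ^+ m = P ^t* *m (T ^+ m) *m P.
Proof.
move=> PP; have PP' : P ^t* *m P = 1%:M by exact: mulmx1C.
elim: m => [|m IH].
  by rewrite !expr0 mulmx1 PP'.
rewrite !exprS IH -!mulmxE !mulmxA; congr (_ *m _ *m _).
by rewrite -(mulmxA _ P) PP mulmx1.
Qed.

Lemma sum_eigenvaluesX n (A : 'M[C]_n) m :
  \sum_(z <- eigenvalues A) z ^+ m = \tr (A ^+ m).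
Proof.
have [P [T [PP tT ->]]] := schur_form A.
rewrite (perm_big _ (eigenvalues_trig PP tT)) /= big_map.
rewrite expmx_unitary_conj// mxtrace_mulC mulmxA PP mul1mx.
by apply: eq_bigr => i _; rewrite (exp_trig m tT).2.
Qed.

(** The squared Hilbert-Schmidt norm as a trace, which makes it invariant
    under unitary conjugation. *)
Lemma sum_norm_mx n (A : 'M[C]_n) :
  \sum_i \sum_j `|A i j| ^+ 2 = \tr (A *m A ^t*).
Proof.
apply: eq_bigr => i _; rewrite mxE; apply: eq_bigr => j _.
by rewrite !mxE normCK.
Qed.

(** Schur inequality: a triangular matrix has at least the
    Hilbert-Schmidt norm of its diagonal. *)
Lemma sum_norm_eigenvalues n (A : 'M[C]_n) :
  \sum_(z <- eigenvalues A) `|z| ^+ 2 <= \sum_i \sum_j `|A i j| ^+ 2.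
Proof.
have [P [T [PP tT ->]]] := schur_form A.
rewrite (perm_big _ (eigenvalues_trig PP tT)) /= big_map sum_norm_mx.
have -> : \tr (P ^t* *m T *m P *m (P ^t* *m T *m P) ^t*) = \tr (T *m T ^t*).
  have -> : (P ^t* *m T *m P) ^t* = P ^t* *m T ^t* *m P.
    by rewrite !trmx_mul !map_mxM trmxCK mulmxA.
  by rewrite -!mulmxA (mulmxA P (P ^t*)) PP mul1mx mxtrace_mulC -!mulmxA PP
    mulmx1.
rewrite -sum_norm_mx; apply: ler_sum => i _.
rewrite (bigD1 i)//= lerDl; apply: sumr_ge0 => j _; exact: exprn_ge0.
Qed.

End eigenvalues_facts.

(** * Moments of a kernel matrix *)

Lemma fdisjointXD (I : choiceType) (A B : {fset I}) :
    [disjoint A & B `\` A]%fset.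
Proof. by apply/fdisjointP => x xA; rewrite !inE xA. Qed.

Section mxpower.
Context {R : realType}.
Local Notation C := R[i].

(** Reduces the powers of a matrix of low rank and large size to those of
    a matrix of fixed size. *)
Lemma mxtrace_expM_swap n p (X : 'M[C]_(n, p)) (Y : 'M[C]_(p, n)) m :
  \tr ((X *m Y) ^+ m.+1) = \tr ((Y *m X) ^+ m.+1).
Proof.
have -> : (X *m Y) ^+ m.+1 = X *m ((Y *m X) ^+ m) *m Y.
  elim: m => [|m IH]; first by rewrite expr1 expr0 mulmx1.
  by rewrite exprS IH -mulmxE [in RHS]exprS -mulmxE !mulmxA.
by rewrite mxtrace_mulC mulmxA -[Y *m X *m _]/(_ * _) -exprS.
Qed.

Lemma cvg_mxX (T : Type) (F : set_system T) {FF : Filter F} p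
    (G : T -> 'M[C]_p) (L : 'M[C]_p) :
  (forall i j, (fun x => G x i j) @ F --> L i j) ->
  forall m i j, (fun x => (G x ^+ m) i j) @ F --> (L ^+ m) i j.
Proof.
move=> GL; elim=> [|m IH] i j; first exact: cvg_cstC.
rewrite exprS -mulmxE mxE; under eq_fun do rewrite exprS -mulmxE mxE.
by apply: cvg_sumC => k; exact: (cvgMC (GL i k) (IH k j)).
Qed.

(** Matrices of size n with entries O(1 / n) form a multiplicatively closed
    class: a product has n terms of size O(1 / n^2) in each entry. *)
Lemma mxX_perturb n (X Y : 'M[C]_n) (b e : C) : 0 <= b -> 0 <= e ->
  (forall i j, `|X i j| <= b / n%:R) -> (forall i j, `|Y i j| <= b / n%:R) ->
  (forall i j, `|X i j - Y i j| <= e / n%:R) ->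
  forall m, (forall i j, `|(Y ^+ m.+1) i j| <= b ^+ m.+1 / n%:R) /\
    (forall i j, `|(X ^+ m.+1 - Y ^+ m.+1) i j| <= m.+1%:R * e * b ^+ m / n%:R).
Proof.
move=> b0 e0 Xb Yb XY.
have sumb (V W : 'M[C]_n) (v w : C) : 0 <= v -> 0 <= w ->
    (forall i j, `|V i j| <= v / n%:R) -> (forall i j, `|W i j| <= w / n%:R) ->
    forall i j, `|(V *m W) i j| <= v * w / n%:R.
  move=> v0 w0 Vv Ww i j; rewrite mxE (le_trans (ler_norm_sum _ _ _))//.
  have n0 : n%:R != 0 :> C by case: n i {V W X Y Xb Yb XY Vv Ww j} => [[]//|n]
    _; rewrite pnatr_eq0.
  apply: (@le_trans _ _ (\sum_(k < n) (v / n%:R) * (w / n%:R))).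
    apply: ler_sum => k _; rewrite normrM; apply: ler_pM => //.
  rewrite sumr_const card_ord -[leLHS]mulr_natl.
  by rewrite mulrCA [n%:R * _]mulrC divfK// mulrAC.
elim=> [|m [IH1 IH2]].
  by split=> i j; rewrite ?expr1 ?mul1r ?expr0 ?mulr1// !mxE XY.
split=> [|i j]; first by rewrite exprS [b ^+ _]exprS; apply: sumb => //;
  exact: exprn_ge0.
have -> : X ^+ m.+2 - Y ^+ m.+2 = X *m (X ^+ m.+1 - Y ^+ m.+1) + (X - Y) *m Y
  ^+ m.+1.
  rewrite [X ^+ m.+2]exprS [Y ^+ m.+2]exprS mulmxBr mulmxBl !mulmxE.
  by rewrite addrA subrK.
rewrite mxE (le_trans (ler_normD _ _))//.
have -> : m.+2%:R * e * b ^+ m.+1 / n%:R =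
   b * (m.+1%:R * e * b ^+ m) / n%:R + e * b ^+ m.+1 / n%:R.
  by rewrite -[m.+2]addn1 natrD exprS; ring.
apply: lerD; apply: sumb => //.
- by rewrite !mulr_ge0// exprn_ge0.
- exact: exprn_ge0.
- by move=> i' j'; rewrite !mxE.
Qed.

Lemma mxtrace_perturb n (X Y : 'M[C]_n) (b e : C) : 0 <= b -> 0 <= e ->
  (forall i j, `|X i j| <= b / n%:R) -> (forall i j, `|Y i j| <= b / n%:R) ->
  (forall i j, `|X i j - Y i j| <= e / n%:R) ->
  forall m, `|\tr (X ^+ m.+1) - \tr (Y ^+ m.+1)| <= m.+1%:R * e * b ^+ m.
Proof.
move=> b0 e0 Xb Yb XY m; have [_ H] := mxX_perturb b0 e0 Xb Yb XY m.
rewrite -raddfB (le_trans (ler_norm_sum _ _ _))//.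
apply: (@le_trans _ _ (\sum_(k < n) (m.+1%:R * e * b ^+ m / n%:R))).
  by apply: ler_sum => k _; exact: H.
rewrite sumr_const card_ord -[leLHS]mulr_natl; case: n {X Y Xb Yb XY H} => [|n].
  by rewrite mul0r !mulr_ge0// exprn_ge0.
by rewrite mulrC divfK// pnatr_eq0.
Qed.

End mxpower.

Section moments.
Local Open Scope sesquilinear_scope.
Context {R : realType} {I : choiceType}.
Local Notation C := R[i].
Variables (c : I -> C) (u : I -> nat -> C) (a : nat -> nat -> C).
Hypothesis c_tail : small_tail c.
Hypothesis u1 : forall k i, `|u k i| <= 1.
Hypothesis a_series : forall i j,
  partial_sum (fun k => c k * (u k i * (u k j)^*)) @ totally --> a i j.
Hypothesis u_orth : forall k l,
  (fun n => n%:R^-1 * \sum_(i < n) ((u k i)^* * u l i)) @ \oo -->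
    ((k == l)%:R : C).

Lemma small_tail_bound : exists2 b : C, 0 <= b &
  forall S : {fset I}, \sum_(k <- S) `|c k| <= b.
Proof.
have [S0 HS0] := c_tail (@ltr01 C).
exists (\sum_(k <- S0) `|c k| + 1) => [|S];
  first by rewrite addr_ge0// sumr_ge0.
have := sum_fsetU (fun k => `|c k|) (fdisjointXD S0 S).
have -> : (S0 `|` (S `\` S0) = S0 `|` S)%fset.
  by apply/fsetP => x; rewrite !inE; case: (x \in S0).
have := sum_fsetU (fun k => `|c k|) (fdisjointXD S S0).
have -> : (S `|` (S0 `\` S) = S0 `|` S)%fset.
  by apply/fsetP => x; rewrite !inE; case: (x \in S0); case: (x \in S).
move=> -> E; rewrite -(lerD2r (\sum_(k <- (S0 `\` S)%fset) `|c k|)) E -addrA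
  lerD2l.
apply: ler_wpDr; first exact: sumr_ge0.
by apply: HS0; exact: fdisjointXD.
Qed.

(** The kernel restricted to the frequencies in S; its matrix has rank at
    most the size of S. *)
Definition partial_kernel (S : {fset I}) i j :=
    \sum_(k <- S) c k * (u k i * (u k j)^*).

Let term_le k i j : `|c k * (u k i * (u k j)^*)| <= `|c k|.
Proof.
rewrite !normrM norm_conjC ler_piMr// -[1](mulr1 1).
by apply: ler_pM.
Qed.

Lemma partial_kernel_le (S : {fset I}) i j :
    `|partial_kernel S i j| <= \sum_(k <- S) `|c k|.
Proof.
by rewrite (le_trans (ler_norm_sum _ _ _))//; apply: ler_sum => k _;
  exact: term_le.
Qed.

Lemma partial_kernel_approx (e : C) : 0 < e ->
  \forall S \near totally, forall i j, `|a i j - partial_kernel S i j| <= e.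
Proof.
move=> e0; have e20 : 0 < e / 2 by rewrite divr_gt0.
have [S0 HS0] := c_tail e20.
exists S0 => // S /= S0S i j.
have /cvgCP/(_ _ e20)[S1 _ HS1] := @a_series i j.
have /= := HS1 (S `|` S1)%fset (fsubsetUr _ _).
rewrite partial_sumE => H.
have -> : a i j - partial_kernel S i j = a i j - partial_kernel (S `|` S1)%fset
  i j + partial_kernel (S1 `\` S)%fset i j.
  have := sum_fsetU (fun k => c k * (u k i * (u k j)^*)) (fdisjointXD S S1).
  have -> : (S `|` (S1 `\` S) = S `|` S1)%fset.
    by apply/fsetP => x; rewrite !inE; case: (x \in S).
  by rewrite /partial_kernel => ->; ring.
rewrite (le_trans (ler_normD _ _))// [leRHS]splitr lerD ?(ltW H)//.
rewrite (le_trans (partial_kernel_le _ _ _))//; apply: HS0.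
by apply: fdisjointWl S0S _; exact: fdisjointXD.
Qed.

Lemma kernel_bound : exists2 b : C, 0 <= b & (forall i j, `|a i j| <= b) /\
  (forall S : {fset I}, \sum_(k <- S) `|c k| <= b).
Proof.
have [b b0 Hb] := small_tail_bound; exists (b + 1); first by rewrite addr_ge0.
split=> [i j|S]; last by rewrite (le_trans (Hb S))// lerDl.
have /filter_ex[S HS] := partial_kernel_approx (@ltr01 C).
rewrite -(subrK (partial_kernel S i j) (a i j)) (le_trans (ler_normD _ _))//.
by rewrite addrC lerD// (le_trans (partial_kernel_le _ _ _)).
Qed.

Definition kernelmx n : 'M[C]_n := \matrix_(i, j) a i j.
Definition scaled_eigenvalues n : seq C :=
    [seq z / n%:R | z <- eigenvalues (kernelmx n)].

Lemma sum_scaled_eigenvaluesX n m :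
  \sum_(z <- scaled_eigenvalues n) z ^+ m = \tr ((n%:R^-1 *: kernelmx n) ^+ m).
Proof.
have -> : (n%:R^-1 *: kernelmx n) ^+ m = n%:R^-1 ^+ m *: kernelmx n ^+ m.
  elim: m => [|m IH]; first by rewrite !expr0 scale1r.
  by rewrite !exprS IH -!mulmxE -scalemxAl -scalemxAr scalerA.
rewrite mxtraceZ -sum_eigenvaluesX big_map mulr_sumr.
by apply: eq_bigr => z _; rewrite exprMn mulrC.
Qed.

Definition partial_kernelmx (S : {fset I}) n : 'M[C]_n :=
    \matrix_(i, j) partial_kernel S i j.

(** The matrix is U D U^t* with U the n by p matrix of the samples, p the
    number of frequencies in S.  By [mxtrace_expM_swap] its moments are those
    of D times the normalized Gram matrix of the columns of U, whose size does
    not depend on n and which tends to the identity by [u_orth]. *)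
Lemma partial_kernelmx_trace_cvg (S : {fset I}) m :
  (fun n => \tr ((n%:R^-1 *: partial_kernelmx S n) ^+ m.+1)) @ \oo -->
  \sum_(k <- S) c k ^+ m.+1.
Proof.
pose t := tnth (in_tuple S); pose p := size S.
pose D : 'M[C]_p := diag_mx (\row_k c (t k)).
pose U n : 'M[C]_(n, p) := \matrix_(i, k) u (t k) i.
have partial_kernelmxE n : n%:R^-1 *: partial_kernelmx S n = U n *m (n%:R^-1 *:
  D *m (U n) ^t*).
  rewrite -scalemxAl -scalemxAr mulmxA; congr (_ *: _).
  apply/matrixP => i j; rewrite !mxE /partial_kernel big_tnth;
    apply: eq_bigr => k _.
  rewrite mul_mx_diag !mxE -/(t k) -/(C); ring.
under eq_fun do rewrite partial_kernelmxE mxtrace_expM_swap.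
have -> : \sum_(k <- S) c k ^+ m.+1 = \tr (D ^+ m.+1).
  rewrite big_tnth; apply: eq_bigr => k _.
  by rewrite (exp_trig _ (diag_mx_is_trig _)).2 !mxE eqxx.
apply: cvg_sumC => i; apply: cvg_mxX => {}i j.
have -> : (fun n => (n%:R^-1 *: D *m (U n) ^t* *m U n) i j) =
    (fun n => c (t i) * (n%:R^-1 * \sum_(x < n) ((u (t i) x)^* * u (t j) x))).
  apply/funext => n; rewrite -2!scalemxAl -mulmxA mul_diag_mx !mxE mulrCA.
  by congr (_ * (_ * _)); apply: eq_bigr => x _; rewrite !mxE.
have -> : D i j = c (t i) * ((t i == t j)%:R : C).
  rewrite !mxE; have -> : (t i == t j) = (i == j).
    apply/eqP/eqP => [|->//]; rewrite /t !(tnth_nth (t i)) => /eqP.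
    by rewrite nth_uniq ?fset_uniq// => /eqP /val_inj.
  by rewrite mulr_natr.
have cc : (fun=> c (t i)) @ \oo --> c (t i) by exact: cvg_cstC.
exact: (cvgMC cc (@u_orth _ _)).
Qed.

(** The partial kernels approximate the kernel uniformly, so the traces of
    powers differ little by [mxtrace_perturb], uniformly in n. *)
Lemma moment_cvg_trace m : (0 < m)%N ->
  moment_cvg scaled_eigenvalues c (fun z => z ^+ m).
Proof.
case: m => // m _ e e0; have [b b0 [ab cb]] := kernel_bound.
have e20 : 0 < e / 2 by rewrite divr_gt0.
have d0 : 0 < m.+1%:R * b ^+ m + 1 by rewrite ltr_wpDl// mulr_ge0// exprn_ge0.
have d'0 : 0 < (e / 2) / (m.+1%:R * b ^+ m + 1) by rewrite divr_gt0.
apply: filterS (partial_kernel_approx d'0) => S HS.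
have /cvgCP/(_ _ e20) := @partial_kernelmx_trace_cvg S m.
apply: filterS => n Hn; rewrite sum_scaled_eigenvaluesX.
set x := \tr _; rewrite -(subrK
  (\tr ((n%:R^-1 *: partial_kernelmx S n) ^+ m.+1)) x).
rewrite -addrA (le_lt_trans (ler_normD _ _))// [ltRHS]splitr ler_ltD//;
  last by rewrite distrC.
have nn : 0 <= n%:R^-1 :> C by rewrite invr_ge0.
apply: (le_trans (mxtrace_perturb b0 (ltW d'0) _ _ _ m)).
- by move=> i j; rewrite !mxE normrM (ger0_norm nn) mulrC ler_wpM2r.
- move=> i j; rewrite !mxE normrM (ger0_norm nn) mulrC ler_wpM2r//.
  exact: le_trans (partial_kernel_le _ _ _) (cb S).
- by move=> i j; rewrite !mxE -mulrBr normrM (ger0_norm nn) mulrC ler_wpM2r.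
rewrite mulrAC mulrC mulrAC ler_pdivrMr//.
by rewrite ler_wpM2l ?(ltW e20)// lerDl.
Qed.

(** The Schur inequality supplies the bound on second moments that
    [count_cvg] needs. *)
Lemma scaled_eigenvalues_cvg (K : set C) (rho : C) : 0 < rho ->
  (forall z, K z -> rho <= `|z|) ->
    (forall k, ~ (closure K `\` interior K) (c k)) ->
  exists S0 : {fset I}, (forall k, K (c k) -> k \in S0) /\
    \forall n \near \oo, (\sum_(z <- scaled_eigenvalues n) `[< K z >] =
      \sum_(k <- S0) `[< K (c k) >])%N.
Proof.
have [b b0 [ab cb]] := kernel_bound.
apply: (@count_cvg R I _ c (b ^+ 2)) => //.
- move=> n; rewrite big_map; have nn : 0 <= n%:R^-1 :> C by rewrite invr_ge0.
  under eq_bigr do rewrite normrM (ger0_norm nn) exprMn.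
  rewrite -mulr_suml.
  apply: (@le_trans _ _ ((\sum_(i < n) \sum_(j < n) b ^+ 2) * n%:R^-1 ^+ 2)).
    rewrite ler_wpM2r ?exprn_ge0// (le_trans (sum_norm_eigenvalues _))//.
    by do 2!(apply: ler_sum => ? _); rewrite mxE lerXn2r ?nnegrE.
  have -> : \sum_(i < n) \sum_(j < n) b ^+ 2 = b ^+ 2 * n%:R ^+ 2.
    by rewrite !sumr_const !card_ord -mulrnA -[LHS]mulr_natr natrM.
  rewrite -mulrA -exprMn ler_piMr ?exprn_ge0//.
  case: n {nn} => [|n]; first by rewrite mul0r expr0n.
  by rewrite divff ?pnatr_eq0// expr1n.
- move=> S; apply: (@le_trans _ _ (\sum_(k <- S) b * `|c k|)).
    apply: ler_sum => k _; rewrite expr2 ler_wpM2r//.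
    by have := cb [fset k]%fset; rewrite big_seq_fset1.
  by rewrite -mulr_sumr expr2 ler_wpM2l.
- by move=> m m2; apply: moment_cvg_trace; exact: ltnW.
Qed.

End moments.

(** * Translation invariance of the Lebesgue measure *)

(** The structure of measure on a pushforward depends on a proof of
    measurability of the map, which unification cannot find; it is an explicit
    argument here. *)
Definition image_measure d d' (T1 : measurableType d) (T2 : measurableType d')
    (R : realType) (m : {measure set T1 -> \bar R}) (f : T1 -> T2)
    (mf : measurable_fun [set: T1] f) : {measure set T2 -> \bar R} :=
  measure_function_pushforward__canonical__measure_function_Measure m mf.

Section translation.
Context {R : realType}.

Lemma measurable_preimageT d d' (T1 : measurableType d) (T2 : measurableType d')
    (f : T1 -> T2) B :
  measurable_fun [set: T1] f -> measurable B -> measurable (f @^-1` B).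
Proof. by move=> mf mB; rewrite -[X in measurable X]setTI; exact: mf. Qed.

Lemma measurable_shift (a : R) :
  measurable_fun [set: measurableTypeR R]
    ((fun x => x - a) : _ -> measurableTypeR R).
Proof. exact: measurable_funB. Qed.

Lemma lebesgue_measure_shift (a : R) (B : set (measurableTypeR R)) :
    measurable B ->
  lebesgue_measure [set x | B (x - a)] = lebesgue_measure B.
Proof.
move=> mB; apply/esym.
apply: (@lebesgue_measure_unique R
  (image_measure lebesgue_measure (measurable_shift a))) => // X [[u v] _ <-].
rewrite /= /pushforward /preimage.
have -> : [set x | `]u, v]%classic (x - a)] = `](u + a), (v + a)]%classic.
  by apply/seteqP; split=> x; rewrite /= !in_itv /= ltrBrDr lerBlDr.
rewrite !lebesgue_measure_itv /= !lte_fin ltrD2r.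
by case: ifP => // _; rewrite -!EFinD; congr EFin; ring.
Qed.

Lemma tnth_vsub d (x y : d.-tuple R) i :
    tnth (vsub x y) i = tnth x i - tnth y i.
Proof. by rewrite tnth_mktuple. Qed.

Lemma measurable_vsubl d (y : d.-tuple R) :
  measurable_fun [set: d.-tuple R] (fun x => vsub x y).
Proof.
apply/measurable_fun_tnthP => i.
rewrite (_ : _ \o _ = fun x => tnth x i - tnth y i); last first.
  by apply/funext => x /=; rewrite tnth_vsub.
by apply: measurable_funB => //; exact: measurable_tnth.
Qed.

Lemma vsub_tcons d (p : measurableTypeR R * d.-tuple R) (y : d.+1.-tuple R) :
  vsub (tcons p) y = tcons (p.1 - thead y, vsub p.2 (behead_tuple y)).
Proof.
apply: eq_from_tnth => i; rewrite tnth_vsub.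
case: (unliftP ord0 i) => [j ->|->]; last by rewrite !tnth0.
rewrite !tnthS tnth_vsub tnth_behead; congr (_ - tnth y _).
by apply: val_inj; rewrite /= inordK// ltnS.
Qed.

(** The translate of a product measure by a vector is the product of the
    translates, so the property passes from the factors by uniqueness of the
    product measure. *)
Lemma lebesgue_Rd_shift d (y : d.-tuple R) (B : set (d.-tuple R)) :
    measurable B ->
  lebesgue_Rd d [set x | B (vsub x y)] = lebesgue_Rd d B.
Proof.
elim: d y B => [|d IH] y B mB.
  by congr (lebesgue_Rd _ _); apply/seteqP; split=> x /=;
    rewrite (tuple0 (vsub x y)) (tuple0 x).
pose s (p : measurableTypeR R * d.-tuple R) : measurableTypeR R * d.-tuple R :=
  (p.1 - thead y, vsub p.2 (behead_tuple y)).
have ms : measurable_fun setT s.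
  apply/measurable_fun_pair => /=.
    exact: (measurableT_comp (measurable_shift _)).
  exact: (measurableT_comp (measurable_vsubl _)).
have mB' := measurable_preimageT (@measurable_tcons R d) mB.
rewrite /= /lebesgue_tcons /pushforward.
rewrite [RHS](@product_measure_unique _ _ _ _ _ _ _
  (image_measure (lebesgue_measure \x lebesgue_Rd d)%E ms))//.
  by congr (_ _); apply/seteqP; split=> p /=; rewrite vsub_tcons.
move=> A1 A2 mA1 mA2; rewrite /= /pushforward.
rewrite (_ : _ @^-1` _ = [set x | A1 (x - thead y)]
  `*` [set x | A2 (vsub x (behead_tuple y))])//.
rewrite product_measure1E; [|exact: (measurable_preimageT (measurable_shift _))
   |exact: (measurable_preimageT (measurable_vsubl _))].
by congr (_ * _)%E; [exact: lebesgue_measure_shift|exact: IH].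
Qed.

End translation.

(** * The integral of a trigonometric wave over the cube *)

Section trig_integrals.
Context {R : realType}.

Lemma sinD2piz (x : R) (k : int) : sin (x + 2 * pi * k%:~R) = sin x.
Proof.
have H (y : R) n : sin (y + 2 * pi * n%:R) = sin y.
  by rewrite mulr_natr mulr_natl (periodicn (@sinD2pi R)).
case: k => n; first exact: H.
by rewrite NegzE mulrNz mulrN -pmulrn -[in RHS](subrK (2 * pi * n.+1%:R) x) H.
Qed.

Definition Omega_side : set R := `[- 2^-1, 2^-1]%classic.

Lemma measurable_Omega_side : measurable (Omega_side : set (measurableTypeR R)).
Proof. exact: measurable_itv. Qed.

Lemma lebesgue_Omega_side : lebesgue_measure
    (Omega_side : set (measurableTypeR R)) = 1%E.
Proof.
rewrite /Omega_side lebesgue_measure_itv/= lte_fin.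
have h : (- 2^-1 < 2^-1 :> R) by rewrite gtrN// invr_gt0.
by rewrite h -EFinD; congr EFin; field.
Qed.

Lemma integral_cos_Omega_side (a : R) (k : int) :
  (\int[lebesgue_measure]_(x in Omega_side)
    (1 + cos (a + 2 * pi * (k%:~R * x)))%:E =
  (1 + (k == 0)%:R * cos a)%:E)%E.
Proof.
have [->|k0] := eqVneq k 0.
  under eq_integral do rewrite mul0r mulr0 addr0.
  rewrite (integral_cst _ measurable_Omega_side) mul1r;
    exact: etrans (congr1 _ lebesgue_Omega_side) (mule1 _).
pose w : R := 2 * pi * k%:~R.
have w0 : w != 0.
  by rewrite /w !mulf_eq0 pnatr_eq0 (gt_eqF (pi_gt0 R))/= intr_eq0.
(* An antiderivative, with the same value of the sine at both ends. *)
pose F (x : R) := x + w^-1 * sin (a + w * x).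
pose f (x : R) := 1 + cos (a + w * x).
have dF (x : R) : is_derive x 1 F (f x).
  have d1 : is_derive x (1 : R) (cst a + w *: (@idfun R)) (0 + w *: 1).
    exact: is_deriveD.
  have d2 := @is_derive1_comp R sin _ x _ _ (is_derive_sin _) d1.
  have d3 := is_deriveD (is_derive_id x (1 : R)) (is_deriveZ w^-1 d2).
  apply: is_derive_eq d3 _.
  rewrite /f /GRing.scale /=.
  by field.
under eq_integral do rewrite mulrA -/w -/(f _).
have cF : continuous F.
  by move=> x; apply: differentiable_continuous; apply/derivable1_diffP;
    case: (dF x).
rewrite (@continuous_FTC2 R f F).
- rewrite /F mul0r addr0 -EFinD; congr EFin.
  have -> : a + w * 2^-1 = (a + w * - 2^-1) + 2 * pi * k%:~R.
    by rewrite -/w; field.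
  by rewrite sinD2piz; field.
- by rewrite gtrN// invr_gt0.
- apply: continuous_subspaceT => x; rewrite /f.
  apply: cvgD; first exact: cvg_cst.
  apply: continuous_comp; last exact: continuous_cos.
  by apply: cvgD; [exact: cvg_cst|exact: mulrl_continuous].
- split => [x _||]; first by case: (dF x).
  + by apply: cvg_at_right_filter; exact: cF.
  + by apply: cvg_at_left_filter; exact: cF.
- by move=> x _; rewrite derive1E; case: (dF x).
Qed.

End trig_integrals.

Section Omega_integrals.
Context {R : realType}.
Implicit Types d : nat.

Lemma measurable_Omega d : measurable (@Omega R d).
Proof.
rewrite (_ : Omega = \bigcap_(i in [set: 'I_d])
  (@tnth d R ^~ i @^-1` Omega_side)).
  apply: fin_bigcap_measurable => // i _.
  exact: measurable_preimageT (@measurable_tnth _ _ _ i) measurable_Omega_side.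
apply/seteqP; split=> x /= h i; first by move=> _;
  rewrite /Omega_side /= in_itv; exact: h.
by have := h i I; rewrite /Omega_side /= in_itv.
Qed.

Lemma measurable_dot d (k : d.-tuple int) :
  measurable_fun [set: d.-tuple R] (dot k).
Proof.
apply: measurable_sum => i; apply: measurable_funM; first exact: measurable_cst.
exact: measurable_tnth.
Qed.

(** Phases 0 and - pi / 2 give the real and the imaginary parts of a
    character. *)
Definition cos_wave d (a : R) (k : d.-tuple int) (x : d.-tuple R) :=
  cos (a + 2 * pi * dot k x).

Lemma measurable_cos_wave d a (k : d.-tuple int) :
    measurable_fun [set: d.-tuple R] (cos_wave a k).
Proof.
apply: (measurableT_comp (continuous_measurable_fun (@continuous_cos R))).
apply: measurable_funD; first exact: measurable_cst.
by apply: measurable_funM; [exact: measurable_cst|exact: measurable_dot].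
Qed.

Lemma dot_tcons d (k : d.+1.-tuple int) (p : measurableTypeR R * d.-tuple R) :
  dot k (tcons p) = (thead k)%:~R * p.1 + dot (behead_tuple k) p.2.
Proof.
rewrite /dot big_ord_recl tnth0; congr (_ + _).
apply: eq_bigr => i _; rewrite tnthS tnth_behead; congr ((tnth k _)%:~R * _).
by apply: val_inj; rewrite /= inordK// ltnS.
Qed.

Lemma tcons_Omega d (p : measurableTypeR R * d.-tuple R) :
  Omega (tcons p) <-> Omega_side p.1 /\ Omega p.2.
Proof.
split=> [h|[h1 h2] i].
  split=> [|i]; first by have := h ord0; rewrite tnth0 /Omega_side /= in_itv.
  by have := h (lift ord0 i); rewrite tnthS.
case: (unliftP ord0 i) => [j ->|->]; first by rewrite tnthS; exact: h2.
by rewrite tnth0; move: h1; rewrite /Omega_side /= in_itv.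
Qed.

(** The summand 1 makes the integrand nonnegative, so that the iterated
    integral may be computed without checking integrability; the phase a makes
    the induction on the dimension work, since the inner integral is the same
    one with a phase that depends on the first coordinate. *)
Lemma integral_cos_wave d (a : R) (k : d.-tuple int) :
  (\int[lebesgue_Rd d]_(x in Omega) (1 + cos_wave a k x)%:E =
   (1 + (k == nseq_tuple d 0)%:R * cos a)%:E)%E.
Proof.
elim: d a k => [|d IH] a k.
  rewrite (_ : Omega = setT); last by apply/seteqP; split=> x //= _ -[].
  rewrite integral_dirac//; last first.
    apply/measurable_EFinP; apply: measurable_funD; first exact: measurable_cst.
    exact: measurable_cos_wave.
  rewrite /dirac indicE in_setT mul1e /cos_wave /dot big_ord0 mulr0 addr0.
  by rewrite [k]tuple0 (_ : _ == _ = true) ?mul1r//; apply/eqP;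
    rewrite (tuple0 (nseq_tuple _ _)).
have ge0 b (l : d.-tuple int) x : (0 <= (1 + cos_wave b l x)%:E :> \bar R)%E.
  by rewrite lee_fin -lerBlDl sub0r cos_geN1.
pose g (x : d.+1.-tuple R) := (1 + cos_wave a k x)%:E.
have mg : measurable_fun setT g.
  apply/measurable_EFinP; apply: measurable_funD; first exact: measurable_cst.
  exact: measurable_cos_wave.
have g0 x : (0 <= g x)%E by rewrite /g lee_fin -lerBlDl sub0r cos_geN1.
rewrite [LHS](@ge0_integral_pushforward _ _ _ _ _ _ (@measurable_tcons R d)
  (lebesgue_measure \x lebesgue_Rd d)%E); last 3 first.
- exact: measurable_Omega.
- exact: measurable_funTS.
- by move=> y _; exact: g0.
have mOm := measurable_preimageT (@measurable_tcons R d)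
  (@measurable_Omega d.+1).
rewrite integral_mkcond fubini_tonelli1; last 2 first.
- apply/(measurable_restrictT _ mOm)/measurable_funTS.
  exact: measurableT_comp mg (@measurable_tcons R d).
- by move=> x; rewrite patchE; case: ifP => _; [exact: g0|exact: lexx].
transitivity (\int[lebesgue_measure]_(x in Omega_side)
  (1 + (behead_tuple k == nseq_tuple d 0)%:R *
  cos (a + 2 * pi * ((thead k)%:~R * x)))%:E)%E.
  rewrite [RHS]integral_mkcond; apply: eq_integral => x _;
    rewrite /fubini_F [RHS]patchE.
  case: ifPn => [|]; rewrite (inE, notin_setE) => xI.
    rewrite -IH [RHS]integral_mkcond; apply: eq_integral => y _.
    rewrite !patchE /=; have -> : ((x, y) \in @tcons R d @^-1` Omega) =
      (y \in Omega).
      apply/idP/idP => /set_mem h; apply/mem_set; first by case/tcons_Omega: h.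
      exact/tcons_Omega.
    case: ifP => // _; rewrite /g /cos_wave dot_tcons /=; congr (1 + cos _)%:E.
    by rewrite mulrDr addrA.
  apply: integral0_eq => y _; rewrite patchE; case: ifP => //.
  by rewrite inE => /tcons_Omega[].
have -> : (k == nseq_tuple d.+1 0) = (thead k == 0) &&
  (behead_tuple k == nseq_tuple d 0).
  by rewrite -!val_eqE /=; case: k {g mg g0} => -[|k0 k] /=.
have [_|_] := eqVneq (behead_tuple k) _.
  rewrite andbT; under eq_integral do rewrite mul1r.
  exact: integral_cos_Omega_side.
rewrite andbF mul0r addr0; under eq_integral do rewrite mul0r addr0.
rewrite (integral_cst _ measurable_Omega_side) mul1e;
  exact: lebesgue_Omega_side.
Qed.

End Omega_integrals.

(** * A strong law for bounded uncorrelated variables *)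

Section strong_law.
Context {R : realType}.

Lemma sqrtn_ex (n : nat) : exists N, (N ^ 2 <= n < N.+1 ^ 2)%N.
Proof.
elim: n => [|n [N /andP[N1 N2]]]; first by exists 0.
have [nN|nN] := ltnP n.+1 (N.+1 ^ 2); first by exists N; rewrite nN ltnW.
exists N.+1; rewrite nN /=; apply: leq_ltn_trans N2 _.
by rewrite ltn_sqr.
Qed.

(** Between consecutive squares N^2 and (N + 1)^2 the sequence s moves by at
    most 2 N, which is negligible compared with N^2. *)
Lemma cvg_mean_squares (s : nat -> R) : (forall n, `|s n.+1 - s n| <= 1) ->
  (fun N => s (N ^ 2)%N / (N ^ 2)%:R) @ \oo --> 0 ->
  (fun n => s n / n%:R) @ \oo --> 0.
Proof.
move=> s1 /cvgrPdist_lt sN; apply/cvgrPdist_lt => e e0.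
have e20 : 0 < e / 2 by rewrite divr_gt0.
have [M1 _ HM1] := sN _ e20.
pose M2 := Num.Def.archi_bound (4 / e).
have HM2 : 4 / e < M2%:R by apply: archi_boundP; rewrite divr_ge0// ltW.
exists ((maxn M1 M2).+1 ^ 2)%N => // n /= Mn.
have [N /andP[N1 N2]] := sqrtn_ex n.
have MN : (maxn M1 M2 < N)%N.
  by rewrite -ltnS -ltn_sqr; apply: leq_ltn_trans N2.
have [M1N M2N] : (M1 <= N)%N /\ (M2 <= N)%N.
  by split; apply: leq_trans (ltnW MN); rewrite ?leq_maxl ?leq_maxr.
have N0 : (0 < N)%N by exact: leq_ltn_trans MN.
have Np : 0 < N%:R :> R by rewrite ltr0n.
have sdist m : `|s (N ^ 2 + m)%N - s (N ^ 2)%N| <= m%:R.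
  elim: m => [|m IH]; first by rewrite addn0 subrr normr0.
  rewrite addnS -(subrKA (s (N ^ 2 + m)%N)) (le_trans (ler_normD _ _))//.
  by rewrite -natr1 addrC lerD.
have := HM1 N M1N; rewrite /= !sub0r !normrN !normrM !normfV !normr_nat => hN.
have n0 : 0 < n%:R :> R by rewrite ltr0n (leq_trans _ N1)// expn_gt0 N0.
rewrite ltr_pdivrMr//.
have NN : (N ^ 2)%:R <= n%:R :> R by rewrite ler_nat.
have N20 : 0 < (N ^ 2)%:R :> R by rewrite ltr0n expn_gt0 N0.
move: hN; rewrite ltr_pdivrMr// => hN.
have := sdist (n - N ^ 2)%N; rewrite subnKC// natrB// => hd.
have h2N : n%:R - (N ^ 2)%:R <= 2 * N%:R :> R.
  have NS : (N.+1 ^ 2 = (N ^ 2 + 2 * N).+1)%N.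
    by rewrite -[N.+1]addn1 sqrnD exp1n muln1 addnAC addn1.
  by move: N2; rewrite NS ltnS -(ler_nat R) natrD natrM lerBlDl.
have h3 : 2 * N%:R <= e / 2 * (N ^ 2)%:R.
  rewrite natrX expr2 mulrA ler_pM2r//.
  have : 4 / e <= N%:R by rewrite (le_trans (ltW HM2))// ler_nat.
  by rewrite ler_pdivrMr//; lra.
have tri : `|s n| <= `|s (N ^ 2)%N| + `|s n - s (N ^ 2)%N|.
  by rewrite addrC -{1}(subrK (s (N ^ 2)%N) (s n)) ler_normD.
have : e / 2 * (N ^ 2)%:R + e / 2 * (N ^ 2)%:R <= e * n%:R.
  by rewrite -mulrDl -splitr ler_pM2l.
lra.
Qed.

(** Telescoping, as 1 / (m + 1)^2 <= 2 / (m + 1) - 2 / (m + 2). *)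
Lemma sum_inv_sqr (k : nat) :
  \sum_(0 <= m < k) (m.+1 ^ 2)%:R^-1 <= 2 - 2 / k.+1%:R :> R.
Proof.
elim: k => [|k IH]; first by rewrite big_nil divr1 subrr.
rewrite big_nat_recr //= (le_trans (lerD IH (lexx _)))//.
have k1 : 0 < k.+1%:R :> R by rewrite ltr0n.
have k2 : 0 < k.+2%:R :> R by rewrite ltr0n.
rewrite natrX -lerBrDl.
have -> : 2 - 2 / k.+2%:R - (2 - 2 / k.+1%:R) = 2 / (k.+1%:R * k.+2%:R) :> R.
  have -> : k.+2%:R = k.+1%:R + 1 :> R by rewrite -[k.+2]addn1 natrD.
  field.
  have k0 : 0 <= k%:R :> R by [].
  by apply/andP; split; apply: lt0r_neq0; lra.
rewrite ler_pdivlMr ?mulr_gt0// mulrC ler_pdivrMr ?exprn_gt0//.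
have -> : k.+2%:R = k.+1%:R + 1 :> R by rewrite -[k.+2]addn1 natrD.
have : 1 <= k.+1%:R :> R by rewrite ler1n.
by nra.
Qed.

Context d (T : measurableType d) (P : probability T R).
Variable (Y : nat -> T -> R).
Hypothesis mY : forall i, measurable_fun setT (Y i).
Hypothesis Y1 : forall i w, `|Y i w| <= 1.
Hypothesis YY : forall i j, i != j -> (\int[P]_w (Y i w * Y j w)%:E = 0)%E.

Lemma bounded_integrable (f : T -> R) (M : R) : measurable_fun setT f ->
  (forall w, `|f w| <= M) -> P.-integrable setT (EFin \o f).
Proof.
move=> mf fM; have PT : (P setT < +oo)%E by rewrite probability_setT ltry.
apply: (measurable_bounded_integrable measurableT PT mf).
exists M; split; first exact: num_real.
by move=> x Mx w _ /=; exact: le_trans (fM w) (ltW Mx).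
Qed.

Let S n w := \sum_(i < n) Y i w.

Let mS n : measurable_fun setT (S n).
Proof. exact: measurable_sum. Qed.

Lemma variance_sum n : (\int[P]_w (S n w ^+ 2)%:E <= n%:R%:E)%E.
Proof.
have mYY i j : measurable_fun setT (fun w =>
  Y i w * Y j w) by exact: measurable_funM.
have YY1 i j w : `|Y i w * Y j w| <= 1.
  by rewrite normrM mulr_ile1.
have iYY i j : P.-integrable setT (EFin \o (fun w => Y i w * Y j w)).
  exact: bounded_integrable (YY1 i j).
have -> : (\int[P]_w (S n w ^+ 2)%:E =
    \int[P]_w (\sum_(i < n) \sum_(j < n) (Y i w * Y j w)%:E))%E.
  apply: eq_integral => w _; rewrite /S expr2 mulr_suml -sumEFin.
  by apply: eq_bigr => i _; rewrite mulr_sumr -sumEFin.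
rewrite integral_sum//; last first.
  by move=> i; apply: integrable_sum => // j _; exact: iYY.
under eq_bigr => i _.
  rewrite integral_sum//; last by move=> j; exact: iYY.
  rewrite (bigD1 i)//= big1 ?adde0; last by move=> j ji; rewrite YY// eq_sym.
  over.
rewrite -[X in (_ <= X%:R%:E)%E](card_ord n) -sum1_card natr_sum -sumEFin.
apply: lee_sum => i _.
have : (\int[P]_w (Y i w * Y i w)%:E <= \int[P]_w (cst 1%:E w))%E.
  apply: ge0_le_integral => //.
  - by move=> w _; rewrite lee_fin -expr2 sqr_ge0.
  - exact/measurable_EFinP.
  - by move=> w _; rewrite lee_fin (le_trans (ler_norm _)).
move=> /le_trans; apply; rewrite (integral_cst P measurableT) mul1e;
  exact: probability_le1.
Qed.

Let Z m w := (S (m.+1 ^ 2) w / (m.+1 ^ 2)%:R) ^+ 2.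

Let mZ m : measurable_fun setT (Z m).
Proof. by apply: measurable_funX; apply: measurable_funM. Qed.

Let Z0 m w : 0 <= Z m w. Proof. exact: sqr_ge0. Qed.

Let intZ m : (\int[P]_w (Z m w)%:E <= ((m.+1 ^ 2)%:R^-1)%:E)%E.
Proof.
have m0 : 0 < (m.+1 ^ 2)%:R :> R by rewrite ltr0n expn_gt0.
under eq_integral do rewrite /Z exprMn EFinM muleC.
rewrite ge0_integralZl//; last 2 first.
- by apply/measurable_EFinP; exact: measurable_funX.
- by move=> w _; rewrite lee_fin sqr_ge0.
apply: (@le_trans _ _ (((m.+1 ^ 2)%:R^-1 ^+ 2)%:E * ((m.+1 ^ 2)%:R)%:E)%E).
  by apply: lee_wpmul2l; [rewrite lee_fin sqr_ge0|exact: variance_sum].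
by rewrite -EFinM lee_fin expr2 mulfVK// gt_eqF.
Qed.

Lemma cvg_square_means :
  {ae P, forall w, (fun m => Z m w) @ \oo --> (0 : R)}.
Proof.
pose W w := (\sum_(0 <= m <oo) (Z m w)%:E)%E.
have mW : measurable_fun setT W.
  by apply: ge0_emeasurable_sum => [m w _ _|m _];
    [rewrite lee_fin|exact/measurable_EFinP].
have W0 w : (0 <= W w)%E by apply: nneseries_ge0 => m _ _; rewrite lee_fin.
have iW : P.-integrable setT W.
  apply/integrableP; split=> //.
  under eq_integral do rewrite gee0_abs//.
  rewrite integral_nneseries//; last 2 first.
  - by move=> m; exact/measurable_EFinP.
  - by move=> m w _; rewrite lee_fin.
  apply: (@le_lt_trans _ _ 2%:E); last exact: ltry.
  apply: lime_le.
    by apply: is_cvg_nneseries => m _ _; apply: integral_ge0 => w _;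
      rewrite lee_fin.
  apply: nearW => k.
  apply: (@le_trans _ _ (\sum_(0 <= m < k) ((m.+1 ^ 2)%:R^-1)%:E)%E).
    by apply: lee_sum => m _; exact: intZ.
  rewrite sumEFin lee_fin (le_trans (sum_inv_sqr k))// lerBlDr lerDl.
  by rewrite divr_ge0.
apply: filterS (integrable_ae measurableT iW) => w /(_ I) Ww.
apply: cvg_series_cvg_0; apply: nondecreasing_is_cvgn.
  by apply/nondecreasing_seqP => n; rewrite /series /= big_nat_recr//= lerDl.
exists (fine (W w)) => _ [n _ <-].
rewrite -lee_fin fineK// /series /= -sumEFin.
by apply: nneseries_lim_ge => m _ _; rewrite lee_fin.
Qed.

(** The mean of n variables has second moment at most 1 / n.  This is
    summable along the squares, where the means therefore converge almost
    surely; [cvg_mean_squares] fills the gaps. *)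
Lemma strong_law_uncorrelated :
  {ae P, forall w, (fun n => (\sum_(i < n) Y i w) / n%:R) @ \oo --> (0 : R)}.
Proof.
apply: filterS cvg_square_means => w Zw.
apply: (@cvg_mean_squares (S ^~ w)).
  by move=> n; rewrite /S big_ord_recr /= addrAC subrr add0r.
rewrite -(cvg_shiftn 1).
apply/cvgrPdist_lt => e e0; move/cvgrPdist_lt : Zw => /(_ (e ^+ 2)).
rewrite exprn_gt0// => /(_ isT); apply: filterS => m /=.
rewrite !sub0r !normrN addn1 /Z normrX.
by rewrite ltr_pXn2r// nnegrE// ltW.
Qed.

End strong_law.

(** * The random sample *)

Section sample.
Context {R : realType} {dT : measure_display} {T : measurableType dT}
  (P : probability T R) {d : nat} (X : nat -> {RV P >-> d.-tuple R}).
Hypothesis Xind : mutually_independent P (fun i => X i).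
Hypothesis Xunif : forall i, uniform_on Omega (distribution P (X i)).

Local Notation Q i := (distribution P (X i)).

Lemma distributionE i B : measurable B -> Q i B = lebesgue_Rd d (B `&` Omega).
Proof.
by move=> mB; rewrite Xunif// lebesgue_Omega inver oner_eq0 invr1 mule1.
Qed.

Lemma measurable_pairX i j : measurable_fun setT (fun w => (X i w, X j w)).
Proof. by apply/measurable_fun_pair; exact: measurable_funPT. Qed.

Lemma joint_distribution i j A : i != j -> measurable A ->
  (Q i \x Q j)%E A = P [set w | A (X i w, X j w)].
Proof.
move=> ij mA.
apply: (@product_measure_unique _ _ _ _ _ _ _
  (image_measure P (measurable_pairX i j))) => // B1 B2 mB1 mB2.
rewrite /= /distribution /pushforward.
pose B n := if n == i then B1 else B2.
have := Xind (J := [fset i; j]%fset) (B := B).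
rewrite big_fsetU1 ?inE//= big_seq_fset1 /B eqxx eq_sym (negbTE ij) => <-.
  congr (P _); apply/seteqP; split=> w /=.
    by move=> [w1 w2] n /=; rewrite !inE => /orP[]/eqP ->;
      rewrite ?eqxx// eq_sym (negbTE ij).
  move=> h; split; first by have := h i; rewrite /= !inE !eqxx; exact.
  by have := h j; rewrite /= !inE eqxx orbT eq_sym (negbTE ij); exact.
by move=> n _; case: ifP.
Qed.

Lemma measurable_vsub :
  measurable_fun [set: d.-tuple R * d.-tuple R] (fun p => vsub p.2 p.1).
Proof.
apply/measurable_fun_tnthP => i.
rewrite (_ : _ \o _ = fun p => tnth p.2 i - tnth p.1 i); last first.
  by apply/funext => x /=; rewrite tnth_vsub.
by apply: measurable_funB; apply: (measurableT_comp (@measurable_tnth _ _ _ i)).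
Qed.

(** The law of the pair is a product law dominated by the Lebesgue measure,
    and the sections of the event are translates of the null set. *)
Lemma ae_difference i j (G : set (d.-tuple R)) : i != j ->
  {ae lebesgue_Rd d, forall x, G x} ->
  {ae P, forall w, G (vsub (X i w) (X j w))}.
Proof.
move=> ij [N [mN N0 GN]].
have mA : measurable ((fun p : d.-tuple R * d.-tuple R =>
  vsub p.2 p.1) @^-1` N).
  exact: measurable_preimageT measurable_vsub mN.
exists [set w | N (vsub (X i w) (X j w))]; split.
- exact: (measurable_preimageT (measurable_pairX j i) mA).
- (* With X j first, the sections of the event are translates of N; with X i
     first they would be reflections. *)
  have ji : j != i by rewrite eq_sym.
  have := joint_distribution ji mA; rewrite /= => <-.
  rewrite /product_measure1; apply: integral0_eq => y _ /=.
  have -> : xsection ((fun p : d.-tuple R * d.-tuple R =>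
    vsub p.2 p.1) @^-1` N) y =
      [set x | N (vsub x y)].
    by apply/seteqP; split=> x; rewrite /xsection /= inE.
  have mNy : measurable [set x | N (vsub x y)].
    exact: measurable_preimageT (measurable_vsubl y) mN.
  rewrite distributionE//; apply/eqP; rewrite eq_le measure_ge0 andbT.
  rewrite -N0 -(lebesgue_Rd_shift y mN); apply: le_measure; rewrite ?inE//.
  by apply: measurableI => //; exact: measurable_Omega.
- by move=> w /= h; apply: GN.
Qed.

Lemma cos_wave_le1 a (k : d.-tuple int) x : `|cos_wave a k x| <= 1 :> R.
Proof. exact: cos_max. Qed.

Lemma integrable_cos_wave (mu : probability (d.-tuple R) R) a
    (k : d.-tuple int) :
  mu.-integrable setT (EFin \o cos_wave a k).
Proof. exact: bounded_integrable (measurable_cos_wave a k) (cos_wave_le1 a k).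
  Qed.

Lemma expectation_cos_wave i a (k : d.-tuple int) : k != nseq_tuple d 0 ->
  (\int[Q i]_x (cos_wave a k x)%:E = 0)%E.
Proof.
move=> k0.
have mc : measurable_fun setT (fun x : d.-tuple R => (1 + cos_wave a k x)%:E).
  apply/measurable_EFinP; apply: measurable_funD; first exact: measurable_cst.
  exact: measurable_cos_wave.
have c0 x : (0 <= (1 + cos_wave a k x)%:E)%E.
  by rewrite lee_fin -lerBlDl sub0r cos_geN1.
have mO := @measurable_Omega R d.
have : (\int[Q i]_x (1 + cos_wave a k x)%:E = 1)%E.
  have QO : Q i (~` Omega) = 0%E.
    rewrite distributionE; last exact: measurableC.
    by rewrite setICl measure0.
  rewrite (ge0_negligible_integral (measurableC mO) measurableT mc (fun x _ =>
    c0 x) QO).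
  rewrite setTD setCK (eq_measure_integral (lebesgue_Rd d)) => [|A mA AO];
    last first.
    by have /= -> := distributionE i mA; rewrite setIidl.
  by rewrite integral_cos_wave (negbTE k0) mul0r addr0.
under eq_integral do rewrite EFinD.
rewrite integralD//; last 2 first.
- apply: (@bounded_integrable _ _ _ (Q i) (cst 1) 1 (measurable_cst _)) => x.
  by rewrite /= normr1.
- exact: integrable_cos_wave.
have -> : (\int[Q i]_x 1%:E = 1)%E.
  by rewrite (integral_cst _ measurableT) mul1e;
    exact: (@probability_setT _ _ _ (Q i)).
case: (integral _ _ _) => [r||]//= [/eqP].
by rewrite -[X in _ == X]addr0 (inj_eq (addrI _)) => /eqP ->.
Qed.

(** Integrating out the second variable already gives 0, by
    [expectation_cos_wave]. *)
Lemma uncorrelated_cos_wave a (k : d.-tuple int) i j : k != nseq_tuple d 0 ->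
    i != j ->
  (\int[P]_w (cos_wave a k (X i w) * cos_wave a k (X j w))%:E = 0)%E.
Proof.
move=> k0 ij.
pose f (p : d.-tuple R * d.-tuple R) := cos_wave a k p.1 * cos_wave a k p.2.
have mf : measurable_fun setT f.
  by apply: measurable_funM; apply: (measurableT_comp
    (measurable_cos_wave a k)).
have f1 p : `|f p| <= 1 by rewrite normrM mulr_ile1// cos_wave_le1.
have mXX : measurable_fun setT (fun w => f (X i w, X j w)).
  exact: measurableT_comp mf (measurable_pairX i j).
have -> : (\int[P]_w (cos_wave a k (X i w) * cos_wave a k (X j w))%:E =
    \int[Q i \x Q j]_p (EFin \o f) p)%E.
  have iXX : P.-integrable ((fun w => (X i w, X j w)) @^-1` setT)
      ((EFin \o f) \o (fun w => (X i w, X j w))).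
    by rewrite preimage_setT; exact: bounded_integrable mXX (fun w => f1 _).
  have mf' : measurable_fun setT (EFin \o f) by exact/measurable_EFinP.
  have := integral_pushforward (measurable_pairX i j) mf' iXX measurableT.
  rewrite preimage_setT => <-.
  rewrite [RHS](eq_measure_integral (image_measure P (measurable_pairX i j)))
    => [//|A mA _].
  by have /= -> := joint_distribution ij mA.
rewrite -integral12_prod_meas1; last first.
  have QQ : ((Q i \x Q j) setT < +oo)%E.
    have /= -> := joint_distribution ij measurableT.
    exact: le_lt_trans (probability_le1 P measurableT) (ltry _).
  apply: (measurable_bounded_integrable measurableT QQ mf).
  exists 1; split; first exact: num_real.
  by move=> M M1 p _ /=; exact: le_trans (f1 p) (ltW M1).
apply: integral0_eq => x _; rewrite /fubini_F.
transitivity ((cos_wave a k x)%:E * \int[Q j]_y (cos_wave a k y)%:E)%E;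
  last first.
  by rewrite expectation_cos_wave// mule0.
by rewrite -integralZl//; exact: integrable_cos_wave.
Qed.

Lemma ae_cos_wave_mean a (k : d.-tuple int) : k != nseq_tuple d 0 ->
  {ae P, forall w, (fun n => (\sum_(i < n) cos_wave a k (X i w)) / n%:R) @ \oo
    --> (0 : R)}.
Proof.
move=> k0; apply: (@strong_law_uncorrelated R _ _ P (fun i w =>
  cos_wave a k (X i w))).
- by move=> i; apply: (measurableT_comp (measurable_cos_wave a k));
  exact: measurable_funPT.
- by move=> i w; exact: cos_wave_le1.
- by move=> i j ij; exact: uncorrelated_cos_wave.
Qed.

Lemma ae_forall_countable (I : countType) (G : I -> T -> Prop) :
  (forall k, {ae P, forall w, G k w}) -> {ae P, forall w, forall k, G k w}.
Proof.
move=> GP.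
have H (n : nat) : {ae P, forall w, oapp (G ^~ w) True (choice.unpickle n)}.
  by case: (choice.unpickle n) => [k|] /=; [exact: GP|exact: aeW].
have := ae_foralln H; apply: filterS => w Gw k.
by have := Gw (choice.pickle k); rewrite choice.pickleK.
Qed.

End sample.

(** * Characters and counting measures *)

Section expi.
Context {R : realType}.
Local Notation C := R[i].

Lemma expi2piD (s t : R) : expi2pi (s + t) = expi2pi s * expi2pi t.
Proof.
rewrite /expi2pi mulrDr cosD sinD; apply/eqP; rewrite eq_complex /=.
by rewrite eqxx /= addrC.
Qed.

Lemma expi2pi0 : expi2pi (0 : R) = 1.
Proof. by rewrite /expi2pi mulr0 cos0 sin0. Qed.

Lemma norm_expi2pi (t : R) : `|expi2pi t| = 1.
Proof. by rewrite normc_def /= cos2Dsin2 sqrtr1. Qed.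

Lemma conj_expi2pi (t : R) : (expi2pi t)^* = expi2pi (- t).
Proof.
have e0 : expi2pi t != 0 by rewrite -normr_eq0 norm_expi2pi oner_eq0.
apply: (mulfI e0); rewrite -normCK norm_expi2pi expr1n.
by rewrite -expi2piD subrr expi2pi0.
Qed.

Lemma Re_expi2pi d (m : d.-tuple int) (x : d.-tuple R) :
  complex.Re (expi2pi (dot m x)) = cos_wave 0 m x.
Proof. by rewrite /cos_wave add0r. Qed.

Lemma Im_expi2pi d (m : d.-tuple int) (x : d.-tuple R) :
  complex.Im (expi2pi (dot m x)) = cos_wave (- (pi / 2)) m x.
Proof. by rewrite /cos_wave addrC cosBpihalf. Qed.

Lemma dot_vsub d (k : d.-tuple int) (x y : d.-tuple R) :
  dot k (vsub x y) = dot k x - dot k y.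
Proof.
rewrite /dot -sumrB; apply: eq_bigr => i _.
by rewrite tnth_vsub mulrBr.
Qed.

Definition freq_sub d (l k : d.-tuple int) : d.-tuple int :=
  [tuple tnth l i - tnth k i | i < d].

Lemma dot_freq_sub d (l k : d.-tuple int) (x : d.-tuple R) :
  dot (freq_sub l k) x = dot l x - dot k x.
Proof.
rewrite /dot -sumrB; apply: eq_bigr => i _.
by rewrite tnth_mktuple rmorphB /= mulrBl.
Qed.

Lemma freq_sub_eq0 d (l k : d.-tuple int) : freq_sub l k = nseq_tuple d 0 ->
    k = l.
Proof.
move=> lk; apply: eq_from_tnth => i; apply/esym/eqP; rewrite -subr_eq0.
by have := congr1 (fun t => tnth t i) lk; rewrite tnth_mktuple => ->;
  rewrite tnth_nseq.
Qed.

(** The product of a character with the conjugate of another one is the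
    character of the difference of their frequencies, whose real and imaginary
    parts are waves of phase 0 and - pi / 2. *)
Lemma cvg_character_mean d (x : nat -> d.-tuple R) :
  (forall m : d.-tuple int, m != nseq_tuple d 0 -> forall b : bool,
    (fun n => (\sum_(i < n) cos_wave (if b then 0 else - (pi / 2)) m (x i)) /
      n%:R) @ \oo --> (0 : R)) ->
  forall k l : d.-tuple int,
  (fun n => n%:R^-1 * \sum_(i < n)
    ((expi2pi (dot k (x i)))^* * expi2pi (dot l (x i)))) @ \oo
    --> ((k == l)%:R : C).
Proof.
move=> H k l.
have E n : n%:R^-1 * \sum_(i < n)
  ((expi2pi (dot k (x i)))^* * expi2pi (dot l (x i))) =
    real_complex R n%:R^-1 * \sum_(i < n) expi2pi (dot (freq_sub l k) (x i)).
  rewrite fmorphV rmorph_nat; congr (_ * _); apply: eq_bigr => i _.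
  by rewrite conj_expi2pi -expi2piD dot_freq_sub addrC.
under eq_fun do rewrite E.
have [<-|kl] := eqVneq k l.
  apply/cvgCP => e e0; exists 1%N => // n /= n0.
  rewrite (eq_bigr (fun=> 1)) => [|i _];
    last by rewrite dot_freq_sub subrr expi2pi0.
  by rewrite sumr_const card_ord fmorphV rmorph_nat mulVf ?subrr ?normr0//
    pnatr_eq0 -lt0n.
have m0 : freq_sub l k != nseq_tuple d 0 by apply: contra_neq kl;
  exact: freq_sub_eq0.
have ReM (r : R) (z : C) : complex.Re (real_complex R r * z) = r * complex.Re z.
  by case: z => a b /=; rewrite mul0r subr0.
have ImM (r : R) (z : C) : complex.Im (real_complex R r * z) = r * complex.Im z.
  by case: z => a b /=; rewrite mul0r addr0.
have Resum n (f : nat -> C) : complex.Re (\sum_(i < n) f i) = \sum_(i < n)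
  complex.Re (f i).
  by apply: (big_morph (@complex.Re R)) => // -[? ?] [].
have Imsum n (f : nat -> C) : complex.Im (\sum_(i < n) f i) = \sum_(i < n)
  complex.Im (f i).
  by apply: (big_morph (@complex.Im R)) => // -[? ?] [].
pose e i := expi2pi (dot (freq_sub l k) (x i)).
apply: cvg_ReIm.
  rewrite (_ : (fun n => complex.Re _) =
      fun n => (\sum_(i < n) cos_wave 0 (freq_sub l k) (x i)) / n%:R).
    exact: (H _ m0 true).
  apply/funext => n; rewrite ReM (Resum n e) mulrC; congr (_ / _).
  by apply: eq_bigr => i _; exact: Re_expi2pi.
rewrite (_ : (fun n => complex.Im _) =
    fun n => (\sum_(i < n) cos_wave (- (pi / 2)) (freq_sub l k) (x i)) / n%:R).
  exact: (H _ m0 false).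
apply/funext => n; rewrite ImM (Imsum n e) mulrC; congr (_ / _).
by apply: eq_bigr => i _; exact: Im_expi2pi.
Qed.

End expi.

Section measures.
Context {R : realType}.
Local Notation C := R[i].

Lemma diracE (z : C) (K : set C) :
    (\d_(z : borelC R) K = (`[< K z >] : nat)%:R%:E :> \bar R)%E.
Proof. by rewrite /dirac indicE. Qed.

Lemma fourier_measure_eq0 d (F : d.-tuple R -> C) (K : set C) :
  fourier_measure F K = 0%E -> forall k, ~ K (fourier_coef F k).
Proof.
move=> F0 k Kk; have : (1 <= fourier_measure F K)%E;
  last by rewrite F0 lee_fin ler10.
apply: esum_ge; exists [set k]; first by split.
by rewrite fsbig_set1 diracE asboolT.
Qed.

Lemma fourier_measureE d (F : d.-tuple R -> C) (K : set C)
    (S : {fset d.-tuple int}) :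
  (forall k, K (fourier_coef F k) -> k \in S) ->
  fourier_measure F K = (\sum_(k <- S) `[< K (fourier_coef F k) >])%N%:R%:E.
Proof.
move=> KS; rewrite /fourier_measure.
have -> : (\esum_(k in [set: d.-tuple int]) \d_(fourier_coef F k : borelC R) K =
    \esum_(k in [set` S]) \d_(fourier_coef F k : borelC R) K :> \bar R)%E.
  rewrite [RHS]esum_mkcond; apply: eq_esum => k _.
  case: ifPn => // kS; rewrite diracE asboolF// => /KS kS'.
  by move/negP: kS; apply; exact: mem_set.
rewrite esum_fset//.
rewrite fsbig_finite//= set_fsetK natr_sum -sumEFin.
by apply: eq_bigr => k _; rewrite diracE.
Qed.

Lemma spectral_measureE n (A : 'M[C]_n) (K : set C) :
  spectral_measure A K =
  (\sum_(z <- [seq z / n%:R | z <- eigenvalues A]) `[< K z >])%N%:R%:E.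
Proof.
rewrite /spectral_measure big_map natr_sum -sumEFin.
by apply: eq_bigr => z _; rewrite diracE.
Qed.

Lemma norm_bounded_below (K : set C) : ~ closure K 0 ->
  exists2 rho : C, 0 < rho & forall z, K z -> rho <= `|z|.
Proof.
move=> K0.
have /(@nbhs_norm0P C C)[rho /= rho0 Hrho] : nbhs (0 : C) (~` closure K).
  by apply: open_nbhs_nbhs; split=> //; apply: closed_openC;
    exact: closed_closure.
exists rho => // z Kz.
have [//|zrho] := real_leP (gtr0_real rho0) (normr_real z).
by case: (Hrho z zrho); exact: (@subset_closure C K).
Qed.

End measures.

(** * Convergence of the spectral measures *)

Theorem theorem1 (R : realType) (dT : measure_display) (T : measurableType dT)
    (P : probability T R) (d : nat) (F : d.-tuple R -> R[i])
    (X : nat -> {RV P >-> d.-tuple R}) :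
  (1 <= d)%N ->
  measurable_fun [set: d.-tuple R] (F : d.-tuple R -> borelC R) ->
  one_periodic F ->
  {ae lebesgue_Rd d, forall x, fourier_sum_at F x} ->
  fourier_sum_at F vzero ->
  mutually_independent P (fun i => X i) ->
  (forall i, uniform_on Omega (distribution P (X i))) ->
  forall K : set (borelC R), measurable K ->
    fourier_measure F (closure (K : set R[i]) `\` interior (K : set R[i])) = 0%E ->
    ~ closure (K : set R[i]) 0 ->
    {ae P, forall w,
      spectral_measure (kernel_matrix F (fun i => X i w) n) K
        @[n --> \oo] --> fourier_measure F K}.
Proof.
move=> _ _ _ Fae F0 Xind Xunif K _ dK0 /norm_bounded_below[rho rho0 Krho].
have dK := fourier_measure_eq0 dK0.
have vsubxx (x : d.-tuple R) : vsub x x = vzero.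
  by apply: eq_from_tnth => i; rewrite tnth_vsub tnth_mktuple subrr.
have c_tail : small_tail (fourier_coef F).
  apply: (@cvg_small_tail _ _ _ (F vzero)).
  move: F0; rewrite /fourier_sum_at.
  rewrite (_ : (fun k => _ * _) = fourier_coef F)//.
  apply/funext => k; rewrite -(vsubxx vzero) dot_vsub subrr expi2pi0 mulr1//.
have ae_series : {ae P, forall w, forall p : nat * nat, p.1 != p.2 ->
    fourier_sum_at F (vsub (X p.1 w) (X p.2 w))}.
  apply: (ae_forall_countable (G := fun p w => p.1 != p.2 ->
    fourier_sum_at F (vsub (X p.1 w) (X p.2 w)))) => -[i j] /=.
  have [ij|ij] := eqVneq i j; first by apply: aeW => w /negP h; case: (h isT).
  by apply: filterS (ae_difference Xind Xunif ij Fae) => w h _; exact: h.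
have ae_means : {ae P, forall w, forall q : d.-tuple int * bool,
    q.1 != nseq_tuple d 0 ->
    (fun n => (\sum_(i < n) cos_wave (if q.2 then 0 else - (pi / 2)) q.1
      (X i w)) / n%:R)
      @ \oo --> (0 : R)}.
  apply: ae_forall_countable => -[m b] /=.
  have [m0|m0] := eqVneq m (nseq_tuple d 0).
    by apply: aeW => w /negP h; case: (h isT).
  by apply: filterS (ae_cos_wave_mean Xind Xunif (if b then 0 else - (pi / 2))
    m0) => w h _; exact: h.
apply: filterS2 ae_series ae_means => w Fw Xw.
have a_series i j : partial_sum (fun k => fourier_coef F k *
    (expi2pi (dot k (X i w)) * (expi2pi (dot k (X j w)))^*)) @ totally -->
    F (vsub (X i w) (X j w)).
  have : fourier_sum_at F (vsub (X i w) (X j w)).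
    by have [->|ij] := eqVneq i j; [rewrite vsubxx|exact: (Fw (i, j))].
  rewrite /fourier_sum_at.
  rewrite (_ : (fun k => _ * expi2pi _) = (fun k => fourier_coef F k *
    (expi2pi (dot k (X i w)) * (expi2pi (dot k (X j w)))^*)))//.
  by apply/funext => k; rewrite conj_expi2pi -expi2piD dot_vsub.
have u_orth := @cvg_character_mean R d (fun i => X i w)
  (fun m m0 b => Xw (m, b) m0).
have u1 (k : d.-tuple int) i :
  `|expi2pi (dot k (X i w))| <= 1 by rewrite norm_expi2pi.
have [S [KS HS]] := scaled_eigenvalues_cvg c_tail u1 a_series u_orth rho0 Krho
  dK.
rewrite (fourier_measureE KS); apply: cvg_near_cst.
apply: filterS HS => n Hn; rewrite -Hn; exact: spectral_measureE.
Qed.
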